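(* Let $\gamma>1$, $\eta>0$, fix a MAC grid $(\mathcal M,\mathcal E)$ of $\Omega$ and a constant time-step $\delta t=T/N$ with $T>0$, $N\ge1$. Let $(\varepsilon^{(k)})_{k\in\mathbb N}$ be a sequence of positive numbers converging to zero. For each $k$ let initial data $(\rho^{(k)}_0,\boldsymbol u^{(k)}_0,\theta^{(k)}_0)\in L^\infty(\Omega)^{d+2}$ be given, and let $(\rho^{(k)},\boldsymbol u^{(k)},\theta^{(k)})$ be the corresponding numerical solution, i.e. with $\varepsilon=\varepsilon^{(k)}$, a solution $(\rho^n,\boldsymbol u^n,\theta^n)_{0\le n\le N}$, with $\rho^n>0$, $\theta^n>0$, of the scheme, $0\le n\le N-1$, $$\frac{1}{\delta t}(\rho_K^{n+1}-\rho_K^n)+\frac1{|K|}\sum_{\sigma\in\mathcal E(K)}F_{\sigma,K}(\rho^n,\boldsymbol u^n)=0,\quad \forall K\in\mathcal M,$$ $$\frac1{\delta t}(\rho^{n+1}_{D_\sigma}u^{n+1}_\sigma-\rho^n_{D_\sigma}u^n_\sigma)+\frac1{|D_\sigma|}\sum_{\epsilon\in\tilde{\mathcal E}(D_\sigma)}F_{\epsilon,\sigma}(\rho^n,\boldsymbol u^n)u^n_{\epsilon,\mathrm{up}}+\frac1{\varepsilon^2}(\partial^{(i)}_{\mathcal E}p^{n+1})_\sigma=0,\quad 1\le i\le d,\ \forall\sigma\in\mathcal E^{(i)}_{\mathrm{int}},$$ $$\frac1{\delta t}(\rho^{n+1}_K\theta^{n+1}_K-\rho^n_K\theta^n_K)+\frac1{|K|}\sum_{\sigma\in\mathcal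 E(K)}F_{\sigma,K}(\rho^{n+1}\theta^{n+1},\boldsymbol v^{n+1})=0,\quad\forall K\in\mathcal M,$$ where $p^n_K=(\rho_K^n\theta_K^n)^\gamma$, started from the averages of the initial data $$\rho^0_K=\frac1{|K|}\int_K\rho^{(k)}_0\,d\boldsymbol x,\quad \theta^0_K=\frac1{|K|}\int_K\theta^{(k)}_0\,d\boldsymbol x\ \ (K\in\mathcal M),\qquad u^0_\sigma=\frac1{|D_\sigma|}\int_{D_\sigma}(\boldsymbol u^{(k)}_0)_i\,d\boldsymbol x\ \ (\sigma\in\mathcal E^{(i)}_{\mathrm{int}},\ 1\le i\le d).$$ Assume that: (a) the initial data are ill-prepared: there are constants $c,C>0$ independent of $k$ such that $\rho^{(k)}_0>0$, $\theta^{(k)}_0>c$ and $$\|\boldsymbol u^{(k)}_0\|_{L^2(\Omega)^d}+\frac1{\varepsilon^{(k)}}\|\rho^{(k)}_0\theta^{(k)}_0-1\|_{L^\infty(\Omega)}\le C;$$ (b) the discrete densities are uniformly bounded: there are constants $0<\underline c<\bar C$, possibly depending on the mesh and the time-step but not on $k$, with $\underline c<(\rho^{(k)})^n_K<\bar C$ for all $K\in\mathcal M$, $0\le n\le N$, $k\in\mathbb N$; (c) for all $k$ and $0\le n\le N-1$, the stability conditions $\eta\ge\frac{3}{2\rho^n_{D_\sigma}}$ for all $\sigma\in\mathcal E_{\mathrm{int}}$ and $\frac{\delta t}{|K|}\sum_{\sigma\in\mathcal E(K)}\frac{|F_{\sigma,K}(\rho^n,\boldsymbol u^n)|}{\rho^n_K}\le\frac13$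 for all $K\in\mathcal M$ hold. For $0\le n\le N$ let $\pi^{(k),n}\in L_{\mathcal M}(\Omega)$ be given by $\pi^{(k),n}_K=\big(p^{(k),n}_K-m(p^{(k),n})\big)/(\varepsilon^{(k)})^2$, where $m(q)$ is the mean value of $q$ over $\Omega$. Then $\rho^{(k)}\theta^{(k)}$ converges to $1$ in $L^\infty(0,T;L^\gamma(\Omega))$ and, up to a subsequence, $(\rho^{(k)},\boldsymbol u^{(k)},\pi^{(k)})$ converges, in any discrete norm, as $k\to\infty$ to some $(\rho,\boldsymbol U,\pi)\in L^\infty(0,T;L_{\mathcal M}(\Omega)\times\boldsymbol H_{\mathcal E,0}(\Omega)\times L_{\mathcal M}(\Omega))$, where the sequence $(\rho^n,\boldsymbol U^n,\pi^n)$ of its values at the time levels is as follows: given $(\rho^n,\boldsymbol U^n,\pi^n)\in L_{\mathcal M}(\Omega)\times\boldsymbol H_{\mathcal E,0}(\Omega)\times L_{\mathcal M}(\Omega)$ at time $t^n$, $(\rho^{n+1},\boldsymbol U^{n+1},\pi^{n+1})\in L_{\mathcal M}(\Omega)\times\boldsymbol H_{\mathcal E,0}(\Omega)\times L_{\mathcal M}(\Omega)$ is obtained as the solution of the semi-implicit scheme $$\frac{1}{\delta t}(\rho_K^{n+1}-\rho_K^n)+\frac1{|K|}\sum_{\sigma\in\mathcal E(K)}F_{\sigma,K}(\rho^n,\boldsymbol U^n)=0,\quad \forall K\in\mathcal M,$$ $$\frac1{\delta t}(\rho^{n+1}_{D_\sigma}U^{n+1}_\sigma-\rho^n_{D_\sigma}U^n_\sigma)+\frac1{|D_\sigma|}\sum_{\epsilon\in\tilde{\mathcal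 E}(D_\sigma)}F_{\epsilon,\sigma}(\rho^n,\boldsymbol U^n)U^n_{\epsilon,\mathrm{up}}+(\partial^{(i)}_{\mathcal E}\pi^{n+1})_\sigma=0,\quad 1\le i\le d,\ \forall\sigma\in\mathcal E^{(i)}_{\mathrm{int}},$$ $$\big(\mathrm{div}_{\mathcal M}(\boldsymbol U^n-\delta\boldsymbol U^{n+1})\big)_K=0,\quad\forall K\in\mathcal M,$$ where $\delta U^{n+1}_\sigma=\eta\,\delta t\,(\partial^{(i)}_{\mathcal E}\pi^{n+1})_\sigma$ for $\sigma\in\mathcal E^{(i)}_{\mathrm{int}}$, $1\le i\le d$.
   Context: Grid. $\Omega$ is a $d$-dimensional box with periodic boundary conditions (i.e. identified with the torus $\mathbb T^d$). A MAC grid $(\mathcal M,\mathcal E)$ consists of a primal mesh $\mathcal M$: a conforming, structured, possibly non-uniform partition of $\bar\Omega$ into closed axis-parallel boxes $K$ (primal cells), and the set $\mathcal E$ of their faces $\sigma$. $\mathcal E^{(i)}$ is the set of faces orthogonal to the $i$-th unit vector $\boldsymbol e^{(i)}$; $\mathcal E(K)$ is the set of faces of $K$. Because of periodicity every face is internal, $\mathcal E_{\mathrm{int}}=\mathcal E$, $\mathcal E^{(i)}_{\mathrm{int}}=\mathcal E^{(i)}$, and each face is $\sigma=K|L$, the common face of two cells $K\ne L$. $|K|$ and $|\sigma|$ denote $d$- and $(d-1)$-dimensional measures ($|\sigma|=1$ if $d=1$). The dual cell $D_\sigma$ of $\sigma=K|L$ is the union of the halves of $K$ and $L$ adjacent to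 $\sigma$, so $|D_\sigma|=\frac12(|K|+|L|)$; $\tilde{\mathcal E}(D_\sigma)$ is the set of faces $\epsilon$ of $D_\sigma$, and $\epsilon=D_\sigma|D_{\sigma'}$ is the face shared by the dual cells of $\sigma,\sigma'\in\mathcal E^{(i)}$. Discrete spaces. $L_{\mathcal M}(\Omega)$: real functions constant on each $K\in\mathcal M$ (value $q_K$). $\boldsymbol H_{\mathcal E}(\Omega)$: vector fields whose $i$-th component is constant on each $D_\sigma$, $\sigma\in\mathcal E^{(i)}$ (value $u_\sigma$), $1\le i\le d$. $\boldsymbol H_{\mathcal E,0}(\Omega)$ is the subspace vanishing on external faces; here there are none, so it equals $\boldsymbol H_{\mathcal E}(\Omega)$. These spaces are finite-dimensional; ''any discrete norm'' means any norm on the discrete function space. A superscript $(k),n$ denotes the value at time level $t^n=n\,\delta t$ of the $k$-th numerical solution; numerical solutions (and $\pi^{(k)}$) are identified with functions piecewise constant in time on the time grid. Notation. $a^+=\max\{a,0\}$, $a^-=\min\{a,0\}$. $\boldsymbol\nu_{\sigma,K}$ is the unit normal to $\sigma$ outward to $K$, and $u_{\sigma,K}=u_\sigma\,\boldsymbol e^{(i)}\cdot\boldsymbol\nu_{\sigma,K}$ for $\sigma\in\mathcal E^{(i)}\cap\mathcal E(K)$. For $\sigma=K|L\in\mathcal E^{(i)}$, $(\partial^{(i)}_{\mathcal E}q)_\sigma=\frac{|\sigma|}{|D_\sigma|}(q_L-q_K)\,\boldsymbol e^{(i)}\cdot\boldsymbol\nu_{\sigma,K}$. The discrete divergence is $(\mathrm{div}_{\mathcal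 M}\boldsymbol v)_K=\frac1{|K|}\sum_{\sigma\in\mathcal E(K)}|\sigma|v_{\sigma,K}$. Mass flux ($\sigma=K|L$): $F_{\sigma,K}(\rho,\boldsymbol u)=|\sigma|\{\rho_K u_{\sigma,K}^++\rho_L u_{\sigma,K}^-\}$. Dual density: $|D_\sigma|\rho_{D_\sigma}=\frac12|K|\rho_K+\frac12|L|\rho_L$. Dual mass fluxes, for $\sigma=K|L\in\mathcal E^{(i)}$, with $F_{\sigma,K}=F_{\sigma,K}(\rho,\boldsymbol u)$: if $\epsilon\subset K$ is orthogonal to $\boldsymbol e^{(i)}$ and $\sigma'$ is the face of $K$ opposite to $\sigma$, $F_{\epsilon,\sigma}=\frac12(F_{\sigma',K}-F_{\sigma,K})$ (similarly in $L$); if $\epsilon$ is not orthogonal to $\boldsymbol e^{(i)}$, it is the union of a half of a face $\tau\in\mathcal E(K)$ and a half of a face $\tau'\in\mathcal E(L)$, and $F_{\epsilon,\sigma}=\frac12(F_{\tau,K}+F_{\tau',L})$. Upwind value: for $\epsilon=D_\sigma|D_{\sigma'}$, $u_{\epsilon,\mathrm{up}}=u_\sigma$ if $F_{\epsilon,\sigma}\ge0$ and $u_{\epsilon,\mathrm{up}}=u_{\sigma'}$ otherwise. Stabilised velocity and temperature flux: $v^{n+1}_\sigma=u^n_\sigma-\delta u^{n+1}_\sigma$ with $\delta u_\sigma^{n+1}=\frac{\eta\,\delta t}{\varepsilon^2}(\partial_{\mathcal E}^{(i)}p^{n+1})_\sigma$ for $\sigma\in\mathcal E^{(i)}_{\mathrm{int}}$;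 with $\delta u_{\sigma,K}=\delta u_\sigma\boldsymbol e^{(i)}\cdot\boldsymbol\nu_{\sigma,K}$, set $(v^{n+1}_{\sigma,K})_+=(u^n_{\sigma,K})^+-(\delta u^{n+1}_{\sigma,K})^-$ and $(v^{n+1}_{\sigma,K})_-=(u^n_{\sigma,K})^--(\delta u^{n+1}_{\sigma,K})^+$; then, for $\sigma=K|L$, $$F_{\sigma,K}(\rho^{n+1}\theta^{n+1},\boldsymbol v^{n+1})=|\sigma|\{\rho^{n+1}_K\theta^{n+1}_K(v^{n+1}_{\sigma,K})_++\rho^{n+1}_L\theta^{n+1}_L(v^{n+1}_{\sigma,K})_-\}.$$
   Formalization: The bound in (a) is also assumed for the discrete initial averages, |ρ^0_K θ^0_K − 1| ≤ Cε for all K (the claim is false without it), and π^{(k)} is shown to converge at time levels 1 ≤ n ≤ N only, since π^{(k),0} may diverge like 1/ε. *)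

(* Defs.v *)
From HB Require Import structures.
From mathcomp Require Import all_boot all_order all_algebra.
From mathcomp Require Import all_classical all_reals all_analysis.
Set Implicit Arguments. Unset Strict Implicit. Unset Printing Implicit Defensive.
Import Order.TTheory GRing.Theory Num.Theory.
Import numFieldNormedType.Exports.
Local Open Scope classical_set_scope.
Local Open Scope ring_scope.

(* R^d with the product Borel sigma-algebra. *)
Definition Rd (R : realType) (d : nat) := d.-tuple (measurableTypeR R).

Section LebesgueCons.
Context (R : realType) (d : nat).
Variable m : {sigma_finite_measure set (Rd R d) -> \bar R}.

Definition pcons (x : measurableTypeR R * Rd R d) : Rd R d.+1 :=
  [tuple of x.1 :: x.2].
Definition puncons (x : Rd R d.+1) : measurableTypeR R * Rd R d :=
  (thead x, [tuple of behead x]).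

Lemma pconsK : cancel pcons puncons.
Proof.
by case=> a x; rewrite /puncons theadE /=; congr pair; exact: val_inj.
Qed.

Lemma measurable_pcons : measurable_fun setT pcons.
Proof. exact: (measurable_cons measurable_fst measurable_snd). Qed.

Lemma measurable_puncons : measurable_fun setT puncons.
Proof.
apply/measurable_fun_pair; first exact: (measurable_tnth ord0).
exact: measurable_behead.
Qed.

Definition lebesgue_cons : set (Rd R d.+1) -> \bar R :=
  pushforward (lebesgue_measure \x m)%E pcons.


Let cons0 : lebesgue_cons set0 = 0%E.
Proof. by rewrite /lebesgue_cons /pushforward preimage_set0 measure0. Qed.

Let cons_ge0 A : (0 <= lebesgue_cons A)%E.
Proof. exact: (measure_ge0 (lebesgue_measure \x m)%E). Qed.

Let cons_sigma_additive : semi_sigma_additive lebesgue_cons.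
Proof.
move=> F mF tF mUF.
apply: (@measure_semi_sigma_additive _ _ _
  (pushforward (lebesgue_measure \x m)%E pcons)) => //.
exact: measurable_pcons.
Qed.

HB.instance Definition _ := isMeasure.Build _ _ _ lebesgue_cons
  cons0 cons_ge0 cons_sigma_additive.

Lemma lebesgue_cons_box (A : set (measurableTypeR R)) (B : set (Rd R d)) :
  measurable A -> measurable B ->
  lebesgue_cons (puncons @^-1` (A `*` B)) = (lebesgue_measure A * m B)%E.
Proof.
move=> mA mB; rewrite /lebesgue_cons /pushforward -comp_preimage.
rewrite (_ : puncons \o pcons = id) ?preimage_id ?product_measure1E//.
by apply/funext => x; exact: pconsK.
Qed.

Let cons_sigma_finite : sigma_finite setT lebesgue_cons.
Proof.
have /sigma_finiteP[F [TF ndF Foo]] := sigma_finiteT (@lebesgue_measure R).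
have /sigma_finiteP[G [TG ndG Goo]] := sigma_finiteT m.
exists (fun n => puncons @^-1` (F n `*` G n)).
  rewrite -preimage_bigcup (_ : \bigcup_n _ = setT) ?preimage_setT//.
  rewrite -setXTT TF TG; apply/seteqP; split => -[x y].
    by move=> [n _ []/= ? ?]; split; exists n.
  move=> [/= [n _ Fnx] [k _ Gky]]; exists (maxn n k) => //; split.
    by move: x Fnx; exact/subsetPset/ndF/leq_maxl.
  by move: y Gky; exact/subsetPset/ndG/leq_maxr.
move=> k; have [? ?] := Foo k; have [? ?] := Goo k; split.
  rewrite -[X in measurable X]setTI; apply: measurable_puncons => //.
  exact: measurableX.
rewrite lebesgue_cons_box//.
by rewrite lte_mul_pinfty// ge0_fin_numE.
Qed.

HB.instance Definition _ := Measure_isSigmaFinite.Build _ _ _ lebesgue_cons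
  cons_sigma_finite.


End LebesgueCons.

(* d-dimensional Lebesgue measure, by iterated products; lebesgue_box below
   gives its value on boxes. *)
Fixpoint lebesgue (R : realType) (d : nat) :
    {sigma_finite_measure set (Rd R d) -> \bar R} :=
  if d is n.+1
  then lebesgue_cons (lebesgue R n)
       : {sigma_finite_measure set (Rd R n.+1) -> \bar R}
  else dirac ([tuple] : Rd R 0) : {sigma_finite_measure set (Rd R 0) -> \bar R}.

Definition box (R : realType) (d : nat) (a b : 'I_d -> R) : set (Rd R d) :=
  [set x | forall i, a i <= tnth x i < b i].

Lemma measurable_box (R : realType) (d : nat) (a b : 'I_d -> R) :
  measurable (box a b).
Proof.
rewrite (_ : box a b = \big[setI/setT]_(i < d)
    ((@tnth d (measurableTypeR R))^~ i @^-1` `[a i, b i[)).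
  apply: bigsetI_measurable => i _; rewrite -[X in measurable X]setTI.
  exact: measurable_tnth.
apply/seteqP; split => x /=; rewrite -bigcap_seq /bigcap/=.
  by move=> xab i _; rewrite in_itv/=; exact: xab.
by move=> xab i; have := xab i (mem_index_enum _); rewrite in_itv/=.
Qed.

Lemma lebesgue_box (R : realType) (d : nat) (a b : 'I_d -> R) :
  (forall i, a i <= b i) ->
  lebesgue R d (box a b) = (\prod_(i < d) (b i - a i))%:E.
Proof.
elim: d a b => [|d IH] a b ab.
  by rewrite big_ord0 /= diracE mem_set// => -[].
rewrite big_ord_recl EFinM -(IH (a \o lift ord0) (b \o lift ord0)); last first.
  by move=> i; exact: ab.
transitivity (lebesgue R d.+1 (@puncons R d @^-1`
    (`[a ord0, b ord0[ `*` box (a \o lift ord0) (b \o lift ord0)))).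
  congr (lebesgue R d.+1 _); apply/seteqP; split => x; case/tupleP: x => h t.
    move=> xab; rewrite -[X in _ X]/(pcons (h, t)) /preimage mksetE (pconsK (h, t)) /= in_itv/=; split.
      exact: (xab ord0).
    by move=> i /=; have := xab (lift ord0 i); rewrite tnthS.
  rewrite -[X in _ X -> _]/(pcons (h, t)) /preimage mksetE (pconsK (h, t)) /= in_itv/= => -[x0 x1] i.
  by case: (unliftP ord0 i) => [j|] ->; [rewrite tnthS; exact: x1|exact: x0].
rewrite /= lebesgue_cons_box//; last exact: measurable_box.
rewrite lebesgue_measure_itv/= lte_fin.
by case: ltgtP (ab ord0) => // ->; rewrite subrr.
Qed.

(* A tensor-product grid, periodic in every direction: the cells in direction i
   are the intervals between node i k and node i k.+1 for k < ncell i, and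
   node i (ncell i) is identified with node i 0.  At least two cells per
   direction, so that a face separates two distinct cells. *)
Record mac_grid (R : realType) (d : nat) := MacGrid {
  ncell : 'I_d -> nat;
  node : 'I_d -> nat -> R;
  ncell_gt1 : forall i, (1 < ncell i)%N;
  node_lt : forall i k, (k < ncell i)%N -> node i k < node i k.+1 }.

Section Grid.
Context (R : realType) (d : nat) (G : mac_grid R d).

Definition domain : set (Rd R d) :=
  box (fun i => node G i 0) (fun i => node G i (ncell G i)).

Definition cell : finType := {dffun forall i : 'I_d, 'I_(ncell G i)}.

(* The neighbour of K in direction +e^(i) (b = true) or -e^(i) (b = false);
   ordS and ord_pred are cyclic, which is the periodicity. *)
Definition neighbour (i : 'I_d) (b : bool) (K : cell) : cell :=
  [ffun j => if j == i then if b then ordS (K j) else ord_pred (K j) else K j].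

(* (i, K) is the face orthogonal to e^(i) between K and neighbour i true K;
   in particular E^(i) is {i} * cell. *)
Definition face : finType := ('I_d * cell)%type.
Implicit Types (s : face) (K : cell).

Definition dir s : 'I_d := s.1.
Definition lcell s : cell := s.2.
Definition rcell s : cell := neighbour s.1 true s.2.

Definition cell_faces K : {set face} :=
  [set s | (K == lcell s) || (K == rcell s)].
Definition face_toward K (j : 'I_d) (b : bool) : face :=
  (j, if b then K else neighbour j false K).

(* For K adjacent to s: the cell L with s = K|L, and e^(i) . nu_(s,K). *)
Definition opp_cell s K : cell := if K == lcell s then rcell s else lcell s.
Definition nu s K : R := if K == lcell s then 1 else -1.

(* Half-open representatives of the closed cells (they differ by null sets and
   partition the domain); |K|, |s|, |D_s|. *)
Definition cell_set K : set (Rd R d) :=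
  box (fun i => node G i (K i)) (fun i => node G i (K i).+1).
Definition width (i : 'I_d) K : R := node G i (K i).+1 - node G i (K i).
Definition cell_vol K : R := \prod_(i < d) width i K.
Definition face_area s : R := \prod_(j < d | j != dir s) width j (lcell s).
Definition dual_vol s : R := (cell_vol (lcell s) + cell_vol (rcell s)) / 2.

Definition midpoint (i : 'I_d) K : R :=
  (node G i (K i) + node G i (K i).+1) / 2.
Definition half_cell K (i : 'I_d) (b : bool) : set (Rd R d) :=
  box (fun j => if b && (j == i) then midpoint j K else node G j (K j))
      (fun j => if ~~ b && (j == i) then midpoint j K else node G j (K j).+1).
Definition dual_cell s : set (Rd R d) :=
  half_cell (lcell s) (dir s) true `|` half_cell (rcell s) (dir s) false.

(* L_M and H_E (= H_(E,0), there being no external face). *)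
Definition LM := {ffun cell -> R^o}.
Definition HE := {ffun face -> R^o}.

Definition cell_fun (q : LM) (x : Rd R d) : R :=
  \sum_K q K * \1_(cell_set K) x.

Definition mean (q : LM) : R :=
  (\sum_K cell_vol K * q K) / (\sum_K cell_vol K).

Definition pos_part (a : R) : R := Num.max a 0.
Definition neg_part (a : R) : R := Num.min a 0.

Definition outward (v : HE) s K : R := v s * nu s K.

Definition grad (q : LM) s : R :=
  face_area s / dual_vol s * (q (rcell s) - q (lcell s)).
Definition divM (v : HE) K : R :=
  (cell_vol K)^-1 * \sum_(s in cell_faces K) face_area s * outward v s K.

Definition mass_flux (rho : LM) (u : HE) s K : R :=
  face_area s * (rho K * pos_part (outward u s K)
                 + rho (opp_cell s K) * neg_part (outward u s K)).

Definition dual_density (rho : LM) s : R :=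
  (cell_vol (lcell s) * rho (lcell s) / 2
   + cell_vol (rcell s) * rho (rcell s) / 2) / dual_vol s.

(* The face of D_s in direction +e^(j) or -e^(j) is indexed by (j, b); it is
   shared with the dual cell of dual_neighbour s (j, b). *)
Definition dual_neighbour s (e : 'I_d * bool) : face :=
  (dir s, neighbour e.1 e.2 s.2).

Definition dual_flux (F : face -> cell -> R) s (e : 'I_d * bool) : R :=
  if e.1 == dir s then
    let K := if e.2 then rcell s else lcell s in
    (F (face_toward K e.1 e.2) K - F s K) / 2
  else
    (F (face_toward (lcell s) e.1 e.2) (lcell s)
     + F (face_toward (rcell s) e.1 e.2) (rcell s)) / 2.

Definition upwind (u : HE) (F : R) s e : R :=
  if 0 <= F then u s else u (dual_neighbour s e).

Definition momentum_convection (rho : LM) (u : HE) s : R :=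
  (dual_vol s)^-1 * \sum_(e : 'I_d * bool)
    dual_flux (mass_flux rho u) s e
    * upwind u (dual_flux (mass_flux rho u) s e) s e.

(* (v_(s,K))_+ and (v_(s,K))_- for v = u - du. *)
Definition split_pos (u du : HE) s K : R :=
  pos_part (outward u s K) - neg_part (outward du s K).
Definition split_neg (u du : HE) s K : R :=
  neg_part (outward u s K) - pos_part (outward du s K).

Definition temperature_flux (rho theta : LM) (u du : HE) s K : R :=
  face_area s * (rho K * theta K * split_pos u du s K
                 + rho (opp_cell s K) * theta (opp_cell s K)
                   * split_neg u du s K).

Definition pressure (gamma : R) (rho theta : LM) : LM :=
  [ffun K => (rho K * theta K) `^ gamma].

Definition mass_balance (dt : R) (rho rho' : LM) (u : HE) : Prop :=
  forall K, dt^-1 * (rho' K - rho K)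
    + (cell_vol K)^-1 * \sum_(s in cell_faces K) mass_flux rho u s K = 0.

Definition momentum_balance (dt : R) (rho rho' : LM) (u u' : HE)
    (gradp : face -> R) : Prop :=
  forall s, dt^-1 * (dual_density rho' s * u' s - dual_density rho s * u s)
    + momentum_convection rho u s + gradp s = 0.

Definition temperature_balance (dt : R) (rho rho' theta theta' : LM)
    (u du : HE) : Prop :=
  forall K, dt^-1 * (rho' K * theta' K - rho K * theta K)
    + (cell_vol K)^-1
      * \sum_(s in cell_faces K) temperature_flux rho' theta' u du s K = 0.

Definition compressible_scheme (gamma eta dt : R) (N : nat) (eps : R)
    (rho : nat -> LM) (u : nat -> HE) (theta : nat -> LM) : Prop :=
  let p n := pressure gamma (rho n) (theta n) in
  (forall n K, (n <= N)%N -> 0 < rho n K /\ 0 < theta n K) /\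
  (forall n, (n < N)%N ->
    [/\ mass_balance dt (rho n) (rho n.+1) (u n),
        momentum_balance dt (rho n) (rho n.+1) (u n) (u n.+1)
          (fun s => (eps ^+ 2)^-1 * grad (p n.+1) s) &
        temperature_balance dt (rho n) (rho n.+1) (theta n) (theta n.+1) (u n)
          [ffun s => eta * dt / eps ^+ 2 * grad (p n.+1) s]]).

Definition incompressible_scheme (eta dt : R) (N : nat)
    (rho : nat -> LM) (U : nat -> HE) (pi : nat -> LM) : Prop :=
  forall n, (n < N)%N ->
    [/\ mass_balance dt (rho n) (rho n.+1) (U n),
        momentum_balance dt (rho n) (rho n.+1) (U n) (U n.+1)
          (grad (pi n.+1)) &
        forall K,
          divM (U n - [ffun s => eta * dt * grad (pi n.+1) s] : HE) K = 0].

Definition initial_averages (rho0 theta0 : Rd R d -> R)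
    (u0 : 'I_d -> Rd R d -> R) (rho : LM) (u : HE) (theta : LM) : Prop :=
  [/\ forall K, rho K =
        (cell_vol K)^-1 * \int[lebesgue R d]_(x in cell_set K) rho0 x,
      forall K, theta K =
        (cell_vol K)^-1 * \int[lebesgue R d]_(x in cell_set K) theta0 x &
      forall s, u s =
        (dual_vol s)^-1 * \int[lebesgue R d]_(x in dual_cell s) u0 (dir s) x].

Definition stability (eta dt : R) (rho : LM) (u : HE) : Prop :=
  (forall s, eta >= 3 / (2 * dual_density rho s)) /\
  (forall K, dt / cell_vol K
     * \sum_(s in cell_faces K) `|mass_flux rho u s K| / rho K <= 3^-1).

Definition rescaled_pressure (eps : R) (p : LM) : LM :=
  [ffun K => (p K - mean p) / eps ^+ 2].

(* The norm of L^p(domain). *)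
Definition LpOmega (p : \bar R) (f : Rd R d -> R) : \bar R :=
  'N[lebesgue R d]_p[EFin \o (f \_ domain)]%E.

Definition in_Linfty (f : Rd R d -> R) : Prop :=
  measurable_fun domain f /\ (LpOmega +oo f < +oo)%E.

Definition L2_vect (u : 'I_d -> Rd R d -> R) : \bar R :=
  LpOmega 2%:E (fun x => Num.sqrt (\sum_i u i x ^+ 2)).

Definition ill_prepared (c C eps : R) (rho0 theta0 : Rd R d -> R)
    (u0 : 'I_d -> Rd R d -> R) : Prop :=
  [/\ {ae lebesgue R d, forall x, domain x -> 0 < rho0 x},
      {ae lebesgue R d, forall x, domain x -> c < theta0 x} &
      (L2_vect u0
       + (eps^-1)%:E * LpOmega +oo (fun x => (rho0 x * theta0 x - 1)%R)
       <= C%:E)%E].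

(* Not implied by ill_prepared: the average of a product is not the product of
   the averages.  Without it rho * theta need not tend to 1: let theta0 take the
   values 1 and 3 on the two halves of each cell, rho0 = 1 / theta0, u0 = 0;
   then rho = 2/3, theta = 2, u = 0 is a stationary discrete solution. *)
Definition ill_prepared_averages (C eps : R) (rho theta : LM) : Prop :=
  forall K, eps^-1 * `|rho K * theta K - 1| <= C.

(* The norm in L^infty(0,T; L^p(domain)) of the function that is piecewise
   constant in time with values f 0, ..., f N at the time levels. *)
Definition LinfLp (N : nat) (p : \bar R) (f : nat -> Rd R d -> R) : \bar R :=
  \big[maxe/0%E]_(n < N.+1) LpOmega p (f n).

(* The space-time discrete functions (rho, u, pi).  The pressure has no
   component at the initial time: pi^(n+1) is its value on (t^n, t^(n+1)],
   and pi^0 does not enter the limit scheme (for ill-prepared data it is of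
   order 1/eps in general). *)
Definition discrete_space (N : nat) : lmodType R :=
  ({ffun 'I_N.+1 -> LM} * {ffun 'I_N.+1 -> HE} * {ffun 'I_N -> LM})%type.

Definition trajectory (N : nat) (rho : nat -> LM) (u : nat -> HE)
    (pi : nat -> LM) : discrete_space N :=
  ([ffun n : 'I_N.+1 => rho n], [ffun n : 'I_N.+1 => u n],
   [ffun n : 'I_N => pi n.+1]).

End Grid.

Definition is_norm (R : realType) (V : lmodType R) (nrm : V -> R) : Prop :=
  [/\ forall x, 0 <= nrm x,
      forall x, nrm x = 0 -> x = 0,
      forall a x, nrm (a *: x) = `|a| * nrm x &
      forall x y, nrm (x + y) <= nrm x + nrm y].

(* Main.v *)
Require Import Defs.
From mathcomp Require Import all_boot all_order all_algebra.
From mathcomp Require Import all_classical all_reals all_analysis.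
From mathcomp Require Import measurable_realfun ring lra.
Set Implicit Arguments.
Unset Strict Implicit.
Unset Printing Implicit Defensive.
Import Order.TTheory GRing.Theory Num.Theory.
Import numFieldNormedType.Exports.
Local Open Scope classical_set_scope.
Local Open Scope ring_scope.

(* Write w = rho theta.  Since the stability condition controls the outflow of
   every cell, the upwind temperature balance satisfies a minimum principle,
   w^(n+1) >= 3/4 min w^n, and the total mass of w is conserved, so w is bounded
   above and below independently of eps.  The stabilisation is a diffusion of
   p = w^gamma with coefficient of order 1/eps^2 and upwinded weight w: summing
   the balance over superlevel sets of p bounds each diffusive flux, hence each
   jump of p / eps^2, by the remaining, bounded, terms.  On the connected grid
   this bounds the rescaled pressures pi^n, n >= 1, and gives p - mean p =
   O(eps^2), so that w = 1 + O(eps) by conservation of mass.  The velocities are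
   bounded for n = 0 by the stability condition, so a subsequence of
   (rho, u^0, pi) converges; the momentum balance then propagates the convergence
   to all u^n, and the three balances pass to the limit. *)

(** * The periodic grid *)

Section Grid.
Context (R : realType) (d : nat) (G : mac_grid R d).
Implicit Types (K L : cell G) (s : face G).

(** There are at least two cells per direction, so the cyclic successor of an index differs from it.
    Hence the two cells of a face are distinct. *)
Lemma neighbour_true_neq (i : 'I_d) K : neighbour i true K != K.
Proof.
apply/eqP => /ffunP/(_ i); rewrite !ffunE eqxx => /(congr1 val) /= eqK.
have := ltn_ord (K i); have := ncell_gt1 G i; move: eqK.
move: (nat_of_ord (K i)) => k; move: (ncell G i) => n eqK n1 kn; move: eqK.
have [nk|nk] := eqVneq k.+1 n.
  by rewrite nk modnn => k0; rewrite -nk -k0 in n1.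
rewrite modn_small; last by rewrite ltn_neqAle nk kn.
by move=> /eqP; rewrite eqn_leq ltnn.
Qed.

Lemma rcell_neq s : (rcell s == lcell s) = false.
Proof. exact/negbTE/neighbour_true_neq. Qed.

(** * Orientation of a face seen from its two cells *)

Lemma nu_lcell s : nu s (lcell s) = 1.
Proof. by rewrite /nu eqxx. Qed.

Lemma nu_rcell s : nu s (rcell s) = -1.
Proof. by rewrite /nu rcell_neq. Qed.

Lemma opp_lcell s : opp_cell s (lcell s) = rcell s.
Proof. by rewrite /opp_cell eqxx. Qed.

Lemma opp_rcell s : opp_cell s (rcell s) = lcell s.
Proof. by rewrite /opp_cell rcell_neq. Qed.

Lemma outward_lcell (v : HE G) s : outward v s (lcell s) = v s.
Proof. by rewrite /outward nu_lcell mulr1. Qed.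

Lemma outward_rcell (v : HE G) s : outward v s (rcell s) = - v s.
Proof. by rewrite /outward nu_rcell mulrN1. Qed.

Lemma lcell_faces s : s \in cell_faces (lcell s).
Proof. by rewrite inE eqxx. Qed.

Lemma rcell_faces s : s \in cell_faces (rcell s).
Proof. by rewrite inE eqxx orbT. Qed.

Lemma cell_facesP s K : s \in cell_faces K -> K = lcell s \/ K = rcell s.
Proof. by rewrite inE => /orP[] /eqP; [left|right]. Qed.

(** Discrete integration by parts: a face belongs to exactly two cells, so a sum over cells can be
    regrouped by faces. *)
Lemma sum_cell_faces (g : face G -> cell G -> R) :
  \sum_K \sum_(s in cell_faces K) g s K
  = \sum_s (g s (lcell s) + g s (rcell s)).
Proof.
under eq_bigr do rewrite big_mkcond /=.
rewrite exchange_big /=; apply: eq_bigr => s _; rewrite -big_mkcond /=.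
rewrite (bigD1 (lcell s)) /=; last exact: lcell_faces.
congr (_ + _).
rewrite (big_pred1 (rcell s))// => K; rewrite inE /=.
have [->|_] := eqVneq K (rcell s); first by rewrite orbT rcell_neq.
by rewrite orbF andbN.
Qed.

(** * Measures and means on the grid *)

Lemma width_gt0 i K : 0 < width i K.
Proof. by rewrite /width subr_gt0; apply: node_lt. Qed.

Lemma cell_vol_gt0 K : 0 < cell_vol K.
Proof. by rewrite /cell_vol; apply: prodr_gt0 => i _; exact: width_gt0. Qed.

Lemma face_area_gt0 s : 0 < face_area s.
Proof. by rewrite /face_area; apply: prodr_gt0 => i _; exact: width_gt0. Qed.

Lemma dual_vol_gt0 s : 0 < dual_vol s.
Proof. by rewrite /dual_vol divr_gt0// addr_gt0// cell_vol_gt0. Qed.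

Definition total_vol : R := \sum_(K : cell G) cell_vol K.

(** The corner cell: common end of the chains of adjacent cells below, and witness that the grid is
    nonempty. *)
Definition cell0 : cell G :=
  [ffun i => Ordinal (ltn_trans (ltn0Sn 0) (ncell_gt1 G i))].

Lemma cell_vol_le_total K : cell_vol K <= total_vol.
Proof.
rewrite /total_vol (bigD1 K)//= lerDl sumr_ge0// => L _.
exact/ltW/cell_vol_gt0.
Qed.

Lemma total_vol_gt0 : 0 < total_vol.
Proof. exact: lt_le_trans (cell_vol_gt0 cell0) (cell_vol_le_total cell0). Qed.

(** Passing to the other cell of the face flips both the normal and the order of the difference. *)
Lemma outward_grad (a : R) (q : LM G) s K : s \in cell_faces K ->
  outward ([ffun s => a * grad q s] : HE G) s K
  = a * (face_area s / dual_vol s) * (q (opp_cell s K) - q K).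
Proof.
move=> /cell_facesP[] ->.
  by rewrite outward_lcell opp_lcell ffunE /grad; ring.
by rewrite outward_rcell opp_rcell ffunE /grad; ring.
Qed.

Lemma mean_bounds (q : LM G) (a b : R) :
  (forall K, a <= q K <= b) -> a <= mean q <= b.
Proof.
move=> qab; rewrite /mean ler_pdivlMr ?ler_pdivrMr ?total_vol_gt0//.
rewrite !mulr_sumr; apply/andP; split; apply: ler_sum => K _;
  have /andP[aq qb] := qab K.
  by rewrite [leLHS]mulrC ler_pM2l ?cell_vol_gt0.
by rewrite [leRHS]mulrC ler_pM2l ?cell_vol_gt0.
Qed.

Lemma dist_mean_le (q : LM G) (B : R) :
  (forall K L, `|q K - q L| <= B) -> forall K, `|q K - mean q| <= B.
Proof.
move=> qB K; rewrite ler_distlC; apply: mean_bounds => L.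
by rewrite -ler_distlC.
Qed.

(** * Positive and negative parts *)

Lemma pos_partN (a : R) : pos_part (- a) = - neg_part a.
Proof. by rewrite /pos_part /neg_part -[in LHS]oppr0 -oppr_min. Qed.

Lemma neg_partN (a : R) : neg_part (- a) = - pos_part a.
Proof. by rewrite /pos_part /neg_part -[in LHS]oppr0 -oppr_max. Qed.

Lemma pos_part_ge0 (a : R) : 0 <= pos_part a.
Proof. by rewrite /pos_part le_max lexx orbT. Qed.

Lemma neg_part_le0 (a : R) : neg_part a <= 0.
Proof. by rewrite /neg_part ge_min lexx orbT. Qed.

Lemma pos_part_id (a : R) : 0 <= a -> pos_part a = a.
Proof. exact: max_l. Qed.

Lemma pos_part_eq0 (a : R) : a <= 0 -> pos_part a = 0.
Proof. exact: max_r. Qed.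

Lemma neg_part_id (a : R) : a <= 0 -> neg_part a = a.
Proof. exact: min_l. Qed.

Lemma neg_part_eq0 (a : R) : 0 <= a -> neg_part a = 0.
Proof. exact: min_r. Qed.

Lemma pos_negD (a : R) : pos_part a + neg_part a = a.
Proof. by rewrite /pos_part /neg_part addr_max_min addr0. Qed.

(* [m] is the length of a chain of adjacent cells from [K] to [L]. *)
Let reach K L : Prop := exists m : nat, forall (q : LM G) (B : R),
  (forall s, `|q (rcell s) - q (lcell s)| <= B) -> `|q K - q L| <= m%:R * B.

Let reach_trans K L M : reach K L -> reach L M -> reach K M.
Proof.
move=> [m1 h1] [m2 h2]; exists (m1 + m2)%N => q B qB.
rewrite (le_trans (ler_distD (q L) _ _))// natrD mulrDl.
by rewrite lerD ?h1 ?h2.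
Qed.

(** Induction on the sum of the indices: a step backwards in a direction with positive index lowers
    the sum by one and never wraps around. *)
Let reach_cell0 K : reach K cell0.
Proof.
have [m] := ubnP (\sum_i (K i : nat)); elim: m K => // m IH K Km.
have [K0|[i Ki]] : (K = cell0) \/ exists i, (0 < K i)%N.
  case: (pickP (fun i => 0 < K i)%N) => [i Ki|K0]; [by right; exists i|].
    left; apply/ffunP => i; rewrite ffunE; apply/val_inj/eqP.
    by rewrite /= -leqn0 leqNgt K0.
  by rewrite K0; exists 0%N => q B _; rewrite subrr normr0 mul0r.
pose K' := neighbour i false K.
have K'i : (K' i : nat) = (K i).-1.
  rewrite ffunE eqxx /=; move: Ki (ltn_ord (K i)).
  case: (nat_of_ord (K i)) => // k _ kn.
  by rewrite addSn /= modnDr modn_small// ltnW.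
apply: (@reach_trans _ K').
  exists 1%N => q B /(_ (i, K')); rewrite mul1r /rcell /lcell /=.
  suff -> : neighbour i true K' = K by [].
  by apply/ffunP => j; rewrite !ffunE; case: eqP => // _; rewrite ord_predK.
apply: IH; rewrite -ltnS; apply: leq_trans Km; rewrite ltnS.
rewrite (bigD1 i)//= [X in (_ < X)%N](bigD1 i)//= K'i.
rewrite (eq_bigr (fun j => K j : nat)).
  by rewrite -addSn prednK.
by move=> j ji; rewrite ffunE (negbTE ji).
Qed.

Lemma oscillation_le_jumps : exists2 M : R, 0 < M &
  forall (q : LM G) (B : R), 0 <= B ->
  (forall s, `|q (rcell s) - q (lcell s)| <= B) ->
  forall K L, `|q K - q L| <= M * B.
Proof.
have [m mP] := choice reach_cell0.
(* The sum of all chain lengths dominates each of them; the successor in the witness makes it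
   positive. *)
pose M : nat := (\sum_K m K)%N.
exists (M + M).+1%:R => // q B B0 qB K L.
rewrite (le_trans (ler_distD (q cell0) _ _))// [X in _ + X]distrC.
have le_m K' : `|q K' - q cell0| <= M%:R * B.
  rewrite (le_trans (mP K' q B qB))// ler_wpM2r// ler_nat /M.
  by rewrite (bigD1 K')//= leq_addr.
rewrite (le_trans (lerD (le_m K) (le_m L)))// -mulrDl ler_wpM2r// -natrD.
by rewrite ler_nat.
Qed.

End Grid.

(** * Estimates for one time step *)

Section Estimates.
Context (R : realType) (d : nat) (G : mac_grid R d).
Variable dt : R.
Hypothesis dt_gt0 : 0 < dt.
Implicit Types (K L : cell G) (s : face G).

(** Where the velocity leaves [K], the upwind mass flux carries the factor [rho K], which the
    division in the stability condition cancels. *)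
Lemma outflow_le (eta : R) (rho : LM G) (u : HE G) :
  (forall K, 0 < rho K) -> stability eta dt rho u ->
  forall K, \sum_(s in cell_faces K) face_area s * pos_part (outward u s K)
    <= cell_vol K / (3 * dt).
Proof.
move=> rho0 [_ cfl] K; have := cfl K; have V0 := cell_vol_gt0 K.
rewrite mulrC -ler_pdivlMr ?divr_gt0// => /(le_trans _) h.
rewrite (_ : _ / _ = 3^-1 / (dt / cell_vol K)); last by field; rewrite !gt_eqF.
apply: h; apply: ler_sum => s _.
rewrite ler_pdivlMr// /mass_flux normrM (gtr0_norm (face_area_gt0 s)) -mulrA.
rewrite ler_pM2l ?face_area_gt0//.
have [u0|u0] := leP 0 (outward u s K).
  by rewrite neg_part_eq0// mulr0 addr0 mulrC ler_norm.
by rewrite pos_part_eq0 ?(ltW u0)// mul0r.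
Qed.

(** The velocity on a face is outgoing for one of its two cells, and there it gives one term of a
    sum of nonnegative ones. *)
Lemma face_flux_le (u : HE G) :
  (forall K, \sum_(s in cell_faces K) face_area s * pos_part (outward u s K)
    <= cell_vol K / (3 * dt)) ->
  forall s, face_area s * `|u s| <= total_vol G / dt.
Proof.
move=> outflow s.
have le_total K : s \in cell_faces K ->
    face_area s * pos_part (outward u s K) <= total_vol G / dt.
  move=> sK; apply: (@le_trans _ _ (cell_vol K / (3 * dt))).
    apply: le_trans (outflow K); rewrite (bigD1 s)//= lerDl sumr_ge0// => s' _.
    by rewrite mulr_ge0 ?pos_part_ge0// ltW// face_area_gt0.
  have V0 := cell_vol_gt0 K; rewrite invfM mulrA ler_pM2r ?invr_gt0//.
  by rewrite (le_trans _ (cell_vol_le_total K))// ler_pdivrMr//; lra.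
have [u0|u0] := leP 0 (u s).
  have := le_total _ (lcell_faces s).
  by rewrite outward_lcell pos_part_id// ger0_norm.
have := le_total _ (rcell_faces s).
by rewrite outward_rcell pos_part_id ?ltr0_norm// oppr_ge0 ltW.
Qed.

(** * One step of the temperature balance *)

Section Step.
Variables (rho rho' theta theta' : LM G) (u : HE G) (kappa : R) (p : LM G).
Let w K : R := rho K * theta K.
Let w' K : R := rho' K * theta' K.
Let du : HE G := [ffun s => kappa * grad p s].
Hypothesis kappa_ge0 : 0 <= kappa.
Hypothesis balance : temperature_balance dt rho rho' theta theta' u du.
Hypothesis w'_gt0 : forall K, 0 < w' K.

Let T s := temperature_flux rho' theta' u du s (lcell s).

Lemma temperature_flux_rcell s :
  temperature_flux rho' theta' u du s (rcell s) = - T s.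
Proof.
rewrite /T /temperature_flux /split_pos /split_neg !outward_lcell !outward_rcell.
by rewrite !pos_partN !neg_partN opp_lcell opp_rcell; ring.
Qed.

(** The balance is multiplied by [f K] and the volume of [K], then summed; conservativity of the
    flux turns the face terms into jumps of [f]. *)
Let tested_balance (f : cell G -> R) :
  \sum_K f K * (cell_vol K / dt * (w' K - w K))
  + \sum_s (f (lcell s) - f (rcell s)) * T s = 0.
Proof.
transitivity (\sum_K (f K * (cell_vol K / dt * (w' K - w K))
    + \sum_(s in cell_faces K) f K * temperature_flux rho' theta' u du s K)).
  rewrite big_split /= sum_cell_faces; congr (_ + _).
  by apply: eq_bigr => s _; rewrite temperature_flux_rcell /T; ring.
apply: big1 => K _; rewrite -mulr_sumr.
have V0 : cell_vol K != 0 by rewrite gt_eqF ?cell_vol_gt0.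
transitivity (f K * cell_vol K * (dt^-1 * (w' K - w K) + (cell_vol K)^-1 *
  \sum_(s in cell_faces K) temperature_flux rho' theta' u du s K)).
  by field; rewrite V0 gt_eqF.
by rewrite balance mulr0.
Qed.

Lemma conservation : \sum_K cell_vol K * w' K = \sum_K cell_vol K * w K.
Proof.
(* A constant test function has no jumps; the value [dt] cancels the division by [dt]. *)
have := tested_balance (fun=> dt).
rewrite [X in _ + X]big1 ?addr0; last by move=> s _; rewrite subrr mul0r.
move=> /eqP h; apply/eqP; rewrite -subr_eq0 -sumrB; apply/eqP.
rewrite -[RHS](eqP h); apply: eq_bigr => K _.
by field; rewrite gt_eqF.
Qed.

(** At a cell [K] where [w'] is minimal, [p] is minimal too, so [du] points outwards and can only
    reduce the net flux out of [K]. This flux is then at most [w' K * (cell_vol K / (3 * dt))],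
    whence [w K <= 4 / 3 * w' K]. *)
Lemma min_principle (a : R) :
  (forall K, \sum_(s in cell_faces K) face_area s * pos_part (outward u s K)
    <= cell_vol K / (3 * dt)) ->
  (forall K L, w' K <= w' L -> p K <= p L) ->
  (forall K, a <= w K) -> forall K, 3 / 4 * a <= w' K.
Proof.
move=> outflow p_mono aw K'.
have [/= K _ minK] := @arg_minP _ _ _ (cell0 G) predT w' isT.
apply: le_trans (minK K' isT); have V0 := cell_vol_gt0 K.
suff : w K <= w' K * (1 + 3^-1) by have := aw K; lra.
have flux_le : \sum_(s in cell_faces K) temperature_flux rho' theta' u du s K
    <= w' K * (cell_vol K / (3 * dt)).
  apply: (@le_trans _ _ (w' K *
    \sum_(s in cell_faces K) face_area s * pos_part (outward u s K))).
    rewrite mulr_sumr; apply: ler_sum => s sK.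
    have du0 : 0 <= outward du s K.
      rewrite outward_grad// mulr_ge0//.
        by rewrite mulr_ge0// divr_ge0// ltW ?face_area_gt0 ?dual_vol_gt0.
      by rewrite subr_ge0 p_mono// minK.
    rewrite /temperature_flux /split_pos /split_neg neg_part_eq0// subr0.
    rewrite (pos_part_id du0) [leRHS]mulrCA ler_pM2l ?face_area_gt0//.
    rewrite gerDl mulr_ge0_le0 ?(ltW (w'_gt0 _))//.
    by rewrite subr_le0 (le_trans (neg_part_le0 _)).
  by rewrite ler_pM2l.
have := balance K; rewrite -/(w K) -/(w' K).
move: flux_le; set F := \sum_(s in _) _ => flux_le bal.
have {}bal : w K = w' K + dt / cell_vol K * F.
  apply/eqP; rewrite -subr_eq0; apply/eqP.
  transitivity (- dt * 0); last by rewrite mulr0.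
  by rewrite -bal; field; rewrite !gt_eqF.
rewrite bal mulrDr mulr1 lerD2l.
apply: le_trans (_ : dt / cell_vol K * (w' K * (cell_vol K / (3 * dt))) <= _).
  by rewrite ler_pM2l// divr_gt0.
by rewrite le_eqVlt; apply/orP; left; apply/eqP; field; rewrite !gt_eqF.
Qed.

(* The balance is summed over the superlevel set of [p] at the larger of
   [p (lcell s)] and [p (rcell s)]: every face of its boundary contributes a
   diffusive flux of the same sign, so the one through [s] is bounded by the
   accumulation and transport terms. *)
Lemma diffusive_flux_le (a W : R) :
  (forall s, face_area s * `|u s| <= total_vol G / dt) ->
  0 <= a -> (forall K, 0 <= w K <= W) -> (forall K, a <= w' K <= W) ->
  forall s, a * (face_area s * `|du s|)
    <= (1 + #|face G|%:R) * (W * (total_vol G / dt)).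
Proof.
move=> u_le a0 wW w'W s0.
(* With this threshold, exactly one side of [s0] lies in the superlevel set when its two pressures
   differ. *)
pose t := Num.max (p (lcell s0)) (p (rcell s0)).
pose f K : R := if t <= p K then 1 else 0.
pose D s := face_area s *
  (w' (lcell s) * neg_part (du s) + w' (rcell s) * pos_part (du s)).
pose Q s := face_area s *
  (w' (lcell s) * pos_part (u s) + w' (rcell s) * neg_part (u s)).
(* [Q] is the transport by [u] and [D] the diffusion by [du], each with its own upwinding. *)
have TE s : T s = Q s - D s.
  rewrite /T /Q /D /temperature_flux /split_pos /split_neg !outward_lcell.
  by rewrite opp_lcell -/(w' _) -/(w' _); ring.
have W0 : 0 <= W by have /andP[w0 /(le_trans w0)] := wW (cell0 G).
have f01 K : 0 <= f K <= 1 by rewrite /f; case: ifP; rewrite lexx ler01.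
have duE s :
    du s = kappa * (face_area s / dual_vol s) * (p (rcell s) - p (lcell s)).
  by rewrite ffunE /grad mulrA.
have k0 s : 0 <= kappa * (face_area s / dual_vol s).
  by rewrite mulr_ge0// divr_ge0// ltW ?face_area_gt0 ?dual_vol_gt0.
(* [f] is nondecreasing in [p], so its jump never has the sign opposite to [du s]; the upwind weight
   that survives is at least [a]. *)
have D_ge s : a * (face_area s * `|du s|) * `|f (rcell s) - f (lcell s)|
    <= (f (rcell s) - f (lcell s)) * D s.
  have A0 := ltW (face_area_gt0 s).
  rewrite /f; have [tr|rt] := leP t (p (rcell s));
    have [tl|lt] := leP t (p (lcell s));
    rewrite /= ?subrr ?normr0 ?mulr0 ?mul0r//.
    have du0 : 0 <= du s.
      by rewrite duE mulr_ge0// subr_ge0 ltW// (lt_le_trans lt).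
    rewrite subr0 normr1 mulr1 mul1r /D neg_part_eq0// pos_part_id//.
    rewrite mulr0 add0r (ger0_norm du0) mulrCA ler_wpM2l// ler_wpM2r//.
    by have /andP[] := w'W (rcell s).
  have du0 : du s <= 0.
    by rewrite duE mulr_ge0_le0// subr_le0 ltW// (lt_le_trans rt).
  rewrite sub0r normrN normr1 mulr1 mulN1r /D neg_part_id// pos_part_eq0//.
  rewrite mulr0 addr0 (ler0_norm du0) -mulrN -mulrN mulrCA ler_wpM2l//.
  rewrite ler_wpM2r ?oppr_ge0//.
  by have /andP[] := w'W (lcell s).
have Q_le s : (f (rcell s) - f (lcell s)) * Q s <= W * (total_vol G / dt).
  have {}Q_le : `|Q s| <= W * (total_vol G / dt).
    apply: le_trans (_ : W * (face_area s * `|u s|) <= _);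
      last by rewrite ler_wpM2l.
    rewrite /Q normrM (gtr0_norm (face_area_gt0 s)) mulrCA.
    rewrite ler_wpM2l ?(ltW (face_area_gt0 s))//.
    have [u0|u0] := leP 0 (u s).
      rewrite neg_part_eq0// pos_part_id// mulr0 addr0 normrM.
      rewrite (ger0_norm (ltW (w'_gt0 _))) ler_wpM2r//.
      by have /andP[] := w'W (lcell s).
    rewrite neg_part_id ?(ltW u0)// pos_part_eq0 ?(ltW u0)// mulr0 add0r normrM.
    rewrite (ger0_norm (ltW (w'_gt0 _))) ler_wpM2r//.
    by have /andP[] := w'W (rcell s).
  rewrite (le_trans (ler_norm _))// normrM (le_trans _ Q_le)//.
  rewrite ler_piMl// ler_norml.
  by have := f01 (rcell s); have := f01 (lcell s); lra.
have acc_le K : f K * (cell_vol K / dt * (w K - w' K)) <= cell_vol K / dt * W.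
  have c0 : 0 < cell_vol K / dt by rewrite divr_gt0 ?cell_vol_gt0.
  have /andP[fK0 fK1] := f01 K.
  rewrite mulrCA ler_pM2l//.
  have /andP[_ wKW] := wW K; have w'K0 := ltW (w'_gt0 K).
  by case: (leP 0 (w K - w' K)) => ?; nra.
(* In the balance tested with [f], accumulation accounts for the summand 1 and transport for at most
   one unit per face. *)
have D_le : \sum_s (f (rcell s) - f (lcell s)) * D s
    <= (1 + #|face G|%:R) * (W * (total_vol G / dt)).
  have -> : \sum_s (f (rcell s) - f (lcell s)) * D s
      = \sum_K f K * (cell_vol K / dt * (w K - w' K))
        + \sum_s (f (rcell s) - f (lcell s)) * Q s.
    have e1 : \sum_K f K * (cell_vol K / dt * (w K - w' K))
        = - \sum_K f K * (cell_vol K / dt * (w' K - w K)).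
      by rewrite -sumrN; apply: eq_bigr => K _; ring.
    have e2 : \sum_s (f (lcell s) - f (rcell s)) * T s
        = \sum_s (f (rcell s) - f (lcell s)) * D s
          - \sum_s (f (rcell s) - f (lcell s)) * Q s.
      by rewrite -sumrB; apply: eq_bigr => s _; rewrite TE; ring.
    by have := tested_balance f; rewrite e1 e2; lra.
  rewrite mulrDl mul1r lerD//.
    apply: (le_trans (ler_sum _ (fun K _ => acc_le K))).
    by rewrite -mulr_suml -mulr_suml mulrC.
  apply: (le_trans (ler_sum _ (fun s _ => Q_le s))).
  by rewrite sumr_const mulr_natl.
have D_ge0 s : 0 <= (f (rcell s) - f (lcell s)) * D s.
  by apply: le_trans (D_ge s); rewrite !mulr_ge0// ltW// face_area_gt0.
(* For equal pressures [f] has no jump at [s0], but then [du s0] vanishes. *)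
have [p_eq|p_neq] := eqVneq (p (lcell s0)) (p (rcell s0)).
  rewrite duE p_eq subrr mulr0 normr0 !mulr0 mulr_ge0//.
  by rewrite mulr_ge0// divr_ge0// ltW// total_vol_gt0.
have f_jump : `|f (rcell s0) - f (lcell s0)| = 1.
  rewrite /f /t !ge_max !lexx /=.
  by case: ltgtP p_neq => //=;
    rewrite ?andbT ?andbF /= ?subr0 ?sub0r ?normrN ?normr1.
apply: le_trans D_le; rewrite (bigD1 s0)//=.
apply: le_trans (_ : (f (rcell s0) - f (lcell s0)) * D s0 <= _).
  by apply: le_trans (D_ge s0); rewrite f_jump mulr1.
by rewrite lerDl sumr_ge0.
Qed.

End Step.
End Estimates.

(** * Bounds uniform in the Mach number *)

(** For [y <= x], let [X], [Y], [A] be the powers of [x], [y], [a] with exponent [gamma - 1]. Then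
    [x * X - y * Y - A * (x - y)] equals [x * (X - Y) + (Y - A) * (x - y)], which is nonnegative. *)
Lemma powR_diff_ge (R : realType) (gamma a x y : R) : 1 < gamma ->
  0 < a -> a <= x -> a <= y ->
  a `^ (gamma - 1) * `|x - y| <= `|x `^ gamma - y `^ gamma|.
Proof.
move=> g1 a0; wlog yx : x y / y <= x => [hw ax ay|ax ay].
  have [/hw|/ltW/hw h] := leP y x; first exact.
  by rewrite distrC [leRHS]distrC; exact: h.
have g0 : 0 <= gamma - 1 by lra.
have nneg z : a <= z -> z \in Num.nneg by move=> az; rewrite nnegrE; lra.
have a_nneg : a \in Num.nneg by rewrite nnegrE ltW.
have le_pow := ge0_ler_powR g0.
have split z : a <= z -> z `^ gamma = z * z `^ (gamma - 1).
  by move=> az; rewrite mulr_powRB1//; lra.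
have := le_pow _ _ a_nneg (nneg _ ay) ay.
have := le_pow _ _ (nneg _ ay) (nneg _ ax) yx.
rewrite !split// (ger0_norm (_ : 0 <= x - y)) ?subr_ge0//.
move: (x `^ _) (y `^ _) (a `^ _) => X Y A YX AY.
apply: le_trans (ler_norm _).
have : 0 <= (Y - A) * (x - y) by rewrite mulr_ge0 ?subr_ge0.
have : 0 <= x * (X - Y) by rewrite mulr_ge0 ?subr_ge0//; lra.
by nra.
Qed.

Section SchemeBounds.
Context (R : realType) (d : nat) (G : mac_grid R d).
Variables (gamma eta dt : R) (N : nat) (C : R).
Hypotheses (gamma_gt1 : 1 < gamma) (eta_gt0 : 0 < eta) (dt_gt0 : 0 < dt).
Implicit Types (K L : cell G) (s : face G).

(** Lower bound for [w]: the initial bound 1/2 after [N] applications of the minimum principle. *)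
Let a : R := (3 / 4) ^+ N / 2.
(** Upper bound for [w]: the total mass is at most [3 / 2 * total_vol G], and the sum of the inverse
    volumes dominates each of them. *)
Let W : R := 3 / 2 * total_vol G * \sum_(K : cell G) (cell_vol K)^-1.

Let a_gt0 : 0 < a.
Proof. by rewrite divr_gt0// exprn_gt0. Qed.

Let W_gt0 : 0 < W.
Proof.
have V0 := @total_vol_gt0 _ _ G; rewrite /W !mulr_gt0//.
rewrite (bigD1 (cell0 G))//= ltr_pwDl ?invr_gt0 ?cell_vol_gt0//.
by apply: sumr_ge0 => K _; rewrite invr_ge0 ltW// cell_vol_gt0.
Qed.

(** The bound on the diffusive flux, solved for the jump of [p] with [eps ^+ 2] taken out; a sum
    over faces stands in for a maximum. *)
Let jump : R := (1 + #|face G|%:R) * (W * (total_vol G / dt)) / (a * (eta * dt))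
  * \sum_(s : face G) dual_vol s / face_area s ^+ 2.

Let jump_coef_ge0 :
  0 <= (1 + #|face G|%:R) * (W * (total_vol G / dt)) / (a * (eta * dt)).
Proof.
have V0 := @total_vol_gt0 _ _ G.
apply: divr_ge0; last exact/ltW/mulr_gt0/mulr_gt0.
apply: mulr_ge0; first by rewrite addr_ge0.
exact/ltW/mulr_gt0/divr_gt0.
Qed.

Let jump_ge0 : 0 <= jump.
Proof.
rewrite mulr_ge0// sumr_ge0// => s _.
by rewrite divr_ge0 ?exprn_ge0// ltW ?dual_vol_gt0 ?face_area_gt0.
Qed.

(** * Bounds for one solution at a fixed small [eps] *)

Section Solution.
Variables (eps : R) (rho : nat -> LM G) (u : nat -> HE G) (theta : nat -> LM G).
Hypothesis eps_gt0 : 0 < eps.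
Hypothesis eps_small : C * eps <= 2^-1.
Hypothesis scheme : compressible_scheme gamma eta dt N eps rho u theta.
Hypothesis prepared : ill_prepared_averages C eps (rho 0%N) (theta 0%N).
Hypothesis stable : forall n, (n < N)%N -> stability eta dt (rho n) (u n).

Let w n K : R := rho n K * theta n K.
Let p n := pressure gamma (rho n) (theta n).

Let w_gt0 n K : (n <= N)%N -> 0 < w n K.
Proof.
by move=> nN; have [r t] := scheme.1 _ K nN; rewrite /w mulr_gt0.
Qed.

Let p_mono n K L : (n <= N)%N -> w n K <= w n L -> p n K <= p n L.
Proof.
move=> nN wKL; rewrite !ffunE; have wK := w_gt0 K nN; have wL := w_gt0 L nN.
by apply: ge0_ler_powR => //; rewrite ?nnegrE ?ltW// (lt_trans ltr01).
Qed.

Let outflow n : (n < N)%N -> forall K,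
  \sum_(s in cell_faces K) face_area s * pos_part (outward (u n) s K)
    <= cell_vol K / (3 * dt).
Proof.
move=> nN; apply: outflow_le (stable nN) => // K.
by have [] := scheme.1 n K (ltnW nN).
Qed.

Let w0_near1 K : `|w 0%N K - 1| <= C * eps.
Proof.
by have := prepared K; rewrite ler_pdivrMl// [eps * C]mulrC.
Qed.

(** The smallness of [eps] enters here: it keeps the initial [w] away from zero, which starts the
    minimum principle. *)
Let w0_bounds K : 1 / 2 <= w 0%N K <= 3 / 2.
Proof.
have := w0_near1 K; move: (w 0%N K) eps_small => x; rewrite ler_norml; lra.
Qed.

Let w_lower n K : (n <= N)%N -> (3 / 4) ^+ n / 2 <= w n K.
Proof.
elim: n K => [|n IH] K nN.
  by rewrite expr0; have /andP[] := w0_bounds K.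
have [_ _ /(@min_principle _ _ G _ dt_gt0)] := scheme.2 n nN.
have k0 : 0 <= eta * dt / eps ^+ 2.
  by rewrite divr_ge0 ?exprn_ge0 ?mulr_ge0// ltW.
move=> /(_ k0) h; rewrite exprS -mulrA.
apply: h => //.
- by move=> L; exact: w_gt0.
- exact: outflow.
- by move=> K1 K2; exact: p_mono.
- by move=> L; exact/IH/ltnW.
Qed.

Let w_ge n K : (n <= N)%N -> a <= w n K.
Proof.
move=> nN; apply: le_trans (w_lower _ nN).
rewrite /a ler_pM2r ?invr_gt0// -(subnK nN) exprD ler_piMl ?exprn_ge0//.
by apply: exprn_ile1; lra.
Qed.

Let w_mass n : (n <= N)%N ->
  \sum_K cell_vol K * w n K = \sum_K cell_vol K * w 0%N K.
Proof.
elim: n => // n IH nN; rewrite -(IH (ltnW nN)).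
have [_ _ /(@conservation _ _ G _ dt_gt0) h] := scheme.2 n nN.
exact: h.
Qed.

(** As [w] is positive, the mass in one cell is at most the conserved total. *)
Let w_le n K : (n <= N)%N -> w n K <= W.
Proof.
move=> nN; have V0 L := cell_vol_gt0 L.
have w0_le : \sum_K cell_vol K * w 0%N K <= 3 / 2 * total_vol G.
  rewrite /total_vol mulr_sumr; apply: ler_sum => L _; rewrite mulrC ler_pM2r//.
  by have /andP[_ w1] := w0_bounds L; exact: w1.
have : cell_vol K * w n K <= 3 / 2 * total_vol G.
  apply: le_trans w0_le; rewrite -(w_mass nN) (bigD1 K)//= lerDl.
  by apply: sumr_ge0 => L _; rewrite mulr_ge0// ltW// w_gt0.
rewrite mulrC -ler_pdivlMr// => /le_trans; apply.
rewrite /W ler_pM2l ?mulr_gt0 ?total_vol_gt0//.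
by rewrite (bigD1 K)//= lerDl sumr_ge0// => L _; rewrite invr_ge0 ltW.
Qed.

(** The stability condition is imposed at levels [n < N]; the last velocity will be reached through
    the momentum balance. *)
Lemma velocity_le n s : (n < N)%N ->
  `|u n s| <= total_vol G / dt * \sum_(s : face G) (face_area s)^-1.
Proof.
move=> nN; have A0 s' := face_area_gt0 s'.
have := face_flux_le dt_gt0 (outflow nN) s.
rewrite mulrC -ler_pdivlMr// => /le_trans; apply.
rewrite ler_pM2l ?divr_gt0 ?total_vol_gt0//.
by rewrite (bigD1 s)//= lerDl sumr_ge0// => s' _; rewrite invr_ge0 ltW.
Qed.

(** [du] carries the coefficient [eta * dt / eps ^+ 2], so a diffusive flux bounded independently of
    [eps] leaves a jump of order [eps ^+ 2]. *)
Lemma pressure_jump_le n s : (n < N)%N ->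
  `|p n.+1 (rcell s) - p n.+1 (lcell s)| <= jump * eps ^+ 2.
Proof.
move=> nN; have A0 s' := face_area_gt0 s'; have D0 s' := dual_vol_gt0 s'.
have k0 : 0 < eta * dt / eps ^+ 2 by rewrite divr_gt0 ?exprn_gt0 ?mulr_gt0.
have [_ _ bal] := scheme.2 n nN.
have := @diffusive_flux_le _ _ G _ dt_gt0 _ _ _ _ _ _ _ (ltW k0) bal _ a W
  _ _ _ _ s.
move=> /(_ _ _ (ltW a_gt0)) h.
have {}h : a * (face_area s * (eta * dt / eps ^+ 2 * (face_area s / dual_vol s *
    `|p n.+1 (rcell s) - p n.+1 (lcell s)|)))
    <= (1 + #|face G|%:R) * (W * (total_vol G / dt)).
  apply: le_trans (h _ _ _ _).
  - rewrite ler_pM2l// ler_pM2l// [X in _ <= `|X|]ffunE /grad normrM.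
    by rewrite [X in _ <= _ * X]normrM (gtr0_norm k0)
      (gtr0_norm (divr_gt0 (A0 s) (D0 s))).
  - by move=> L; exact: w_gt0.
  - exact: (face_flux_le dt_gt0 (outflow nN)).
  - by move=> L; rewrite ltW ?w_gt0 ?w_le// ltnW.
  - by move=> L; rewrite w_ge ?w_le.
have {}h : `|p n.+1 (rcell s) - p n.+1 (lcell s)| <=
    (1 + #|face G|%:R) * (W * (total_vol G / dt)) / (a * (eta * dt))
    * (dual_vol s / face_area s ^+ 2) * eps ^+ 2.
  move: h; set X := `|_|; set Y := (_ * (W * _)) => h.
  have -> : X = a * (face_area s * (eta * dt / eps ^+ 2 *
      (face_area s / dual_vol s * X)))
      / (a * (eta * dt)) * (dual_vol s / face_area s ^+ 2) * eps ^+ 2.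
    move: (face_area s) (dual_vol s) (A0 s) (D0 s) => A D A1 D1.
    by field; rewrite !gt_eqF.
  rewrite ler_pM2r ?exprn_gt0// ler_pM2r;
    last exact: divr_gt0 (D0 s) (exprn_gt0 _ (A0 s)).
  by rewrite ler_pM2r// invr_gt0 !mulr_gt0.
apply: (le_trans h); rewrite ler_pM2r ?exprn_gt0// ler_wpM2l//.
rewrite (bigD1 s)//= lerDl sumr_ge0// => s' _.
by rewrite divr_ge0 ?exprn_ge0// ltW.
Qed.

Variable M : R.
Hypothesis M_ge0 : 0 <= M.
Hypothesis oscillation : forall (q : LM G) (B : R), 0 <= B ->
  (forall s, `|q (rcell s) - q (lcell s)| <= B) ->
  forall K L, `|q K - q L| <= M * B.

Lemma pressure_oscillation_le n K L : (n < N)%N ->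
  `|p n.+1 K - p n.+1 L| <= M * (jump * eps ^+ 2).
Proof.
move=> nN; apply: oscillation => [|s]; last exact: pressure_jump_le.
by rewrite mulr_ge0 ?exprn_ge0// ltW.
Qed.

Lemma rescaled_pressure_le n K : (n < N)%N ->
  `|rescaled_pressure eps (p n.+1) K| <= M * jump.
Proof.
move=> nN; have e2 : 0 < eps ^+ 2 by rewrite exprn_gt0.
rewrite ffunE normrM [X in _ * X]gtr0_norm ?invr_gt0// ler_pdivrMr// -mulrA.
by apply: dist_mean_le => K1 K2; exact: pressure_oscillation_le.
Qed.

(** Triangle inequality through the mean of [w]: the oscillation of [p] controls that of [w] because
    [w >= a], and by conservation the mean is the initial one, within [C * eps] of 1. At level 0 the
    first term is slack. *)
Lemma rho_theta_near1 n K : (n <= N)%N ->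
  `|w n K - 1| <= M * jump / a `^ (gamma - 1) * eps ^+ 2 + C * eps.
Proof.
have a_pow : 0 < a `^ (gamma - 1) by exact: powR_gt0.
case: n => [_|n nN].
  apply: le_trans (w0_near1 K) _; rewrite lerDr.
  rewrite mulr_ge0 ?exprn_ge0 ?(ltW eps_gt0)// divr_ge0 ?(ltW a_pow)//.
  exact: mulr_ge0.
have mass m : (m <= N)%N -> mean [ffun K => w m K] = mean [ffun K => w 0%N K].
  move=> mN; rewrite /mean; congr (_ / _).
  under eq_bigr do rewrite ffunE; under [RHS]eq_bigr do rewrite ffunE.
  exact: w_mass.
rewrite (le_trans (ler_distD (mean [ffun K => w n.+1 K]) _ _))// lerD//.
  have osc K1 K2 : `|[ffun K => w n.+1 K] K1 - [ffun K => w n.+1 K] K2|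
      <= M * jump / a `^ (gamma - 1) * eps ^+ 2.
    rewrite !ffunE mulrAC ler_pdivlMr// mulrC -mulrA.
    apply: le_trans (powR_diff_ge gamma_gt1 a_gt0 _ _) _; [exact: w_ge..|].
    by have := pressure_oscillation_le K1 K2 nN; rewrite !ffunE.
  by have := dist_mean_le osc K; rewrite ffunE.
rewrite mass// ler_distl.
by apply: mean_bounds => L; rewrite ffunE -ler_distl.
Qed.

End Solution.

(** The constant is chosen before [eps] and the solution, which makes the bounds uniform in the Mach
    number. *)
Lemma compressible_scheme_bounds : exists2 B : R, 0 <= B & forall (eps : R)
    (rho : nat -> LM G) (u : nat -> HE G) (theta : nat -> LM G),
  0 < eps -> C * eps <= 2^-1 ->
  compressible_scheme gamma eta dt N eps rho u theta ->
  ill_prepared_averages C eps (rho 0%N) (theta 0%N) ->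
  (forall n, (n < N)%N -> stability eta dt (rho n) (u n)) ->
  [/\ forall n s, (n < N)%N -> `|u n s| <= B,
      forall n K, (n < N)%N -> `|rescaled_pressure eps
        (pressure gamma (rho n.+1) (theta n.+1)) K| <= B &
      forall n K, (n <= N)%N ->
        `|rho n K * theta n K - 1| <= B * eps ^+ 2 + C * eps].
Proof.
have [M M0 osc] := oscillation_le_jumps G.
pose B1 := total_vol G / dt * \sum_(s : face G) (face_area s)^-1.
pose B2 := M * jump; pose B3 := M * jump / a `^ (gamma - 1).
have B10 : 0 <= B1.
  apply: mulr_ge0; first exact/ltW/divr_gt0/dt_gt0/total_vol_gt0.
  by apply: sumr_ge0 => s _; rewrite invr_ge0 ltW ?face_area_gt0.
have B20 : 0 <= B2 by rewrite mulr_ge0// ltW.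
have B30 : 0 <= B3 by rewrite divr_ge0 ?powR_ge0.
exists (B1 + B2 + B3); first by rewrite !addr_ge0.
move=> eps rho u theta eps0 eps_small sch prep stab; split.
- move=> n s nN; apply: le_trans (velocity_le sch stab s nN) _.
  rewrite -/B1; lra.
- move=> n K nN.
  have := rescaled_pressure_le eps0 eps_small sch prep stab osc K nN.
  by move=> /le_trans; apply; rewrite -/B2; lra.
- move=> n K nN.
  have := rho_theta_near1 eps0 eps_small sch prep stab (ltW M0) osc K nN.
  by move=> /le_trans; apply;
    rewrite lerD2r ler_wpM2r ?exprn_ge0 ?(ltW eps0)// -/B3; lra.
Qed.

End SchemeBounds.

(** * Convergence in finite-dimensional spaces *)

Lemma homo_ltn_cvg (phi : nat -> nat) :
  {homo phi : i j / (i < j)%N} -> phi @ \oo --> \oo.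
Proof.
move=> phi_incr; have phi_ge n : (n <= phi n)%N.
  by elim: n => // n IH; apply: leq_ltn_trans IH (phi_incr _ _ _).
apply/cvgnyPge => A; exists A => //= n An; exact: leq_trans (phi_ge n).
Qed.

(** Coordinates are treated one at a time; each new extraction refines the previous ones, whose
    limits survive. *)
Lemma bolzano_weierstrass_finite (R : realType) (I : finType)
    (f : nat -> I -> R) (M : R) : (forall k i, `|f k i| <= M) ->
  exists2 phi : nat -> nat, {homo phi : i j / (i < j)%N} &
    forall i, cvgn (fun k => f (phi k) i).
Proof.
move=> fM; suff [phi phi_incr cv] : exists2 phi : nat -> nat,
    {homo phi : i j / (i < j)%N} &
    forall i, i \in enum I -> cvgn (fun k => f (phi k) i).
  by exists phi => // i; apply: cv; rewrite mem_enum.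
elim: (enum I) => [|i s [phi phi_incr IH]]; first by exists id.
have [|psi psi_incr cv] := @bolzano_weierstrass R (fun k => f (phi k) i).
  exists M; split; first exact: num_real.
  by move=> x Mx k _ /=; apply: le_trans (ltW Mx).
have {}psi_incr : {homo psi : i j / (i < j)%N}.
  by move=> j k; rewrite !ltnNge -!leEnat psi_incr.
exists (phi \o psi) => [j k jk|j]; first exact/phi_incr/psi_incr.
rewrite inE => /predU1P[->//|/IH /cvg_ex[l fl]].
by apply/cvg_ex; exists l; apply: cvg_comp fl; exact: homo_ltn_cvg.
Qed.

Lemma cvg_sumr (R : realType) (I : Type) (r : seq I) (P : pred I)
    (f : nat -> I -> R) (l : I -> R) :
  (forall i, P i -> f k i @[k --> \oo] --> l i) ->
  \sum_(i <- r | P i) f k i @[k --> \oo] --> \sum_(i <- r | P i) l i.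
Proof. by apply: cvg_big; exact: add_continuous. Qed.

Section NullSequences.
Variable R : realType.
Implicit Types V : lmodType R.

Definition seminorm V (p : V -> R) :=
  (forall a x, p (a *: x) = `|a| * p x) /\ (forall x y, p (x + y) <= p x + p y).

(* Convergence to 0 in every seminorm: on a finite-dimensional space, in every
   norm.  This form passes to finite products without any choice of basis. *)
Definition null_seq V (x : nat -> V) :=
  forall p, seminorm p -> p (x k) @[k --> \oo] --> (0 : R).

(** By [0 = p (x - x) <= p x + p (- x) = 2 * p x]. *)
Lemma seminorm_ge0 V (p : V -> R) : seminorm p -> forall x, 0 <= p x.
Proof.
move=> [pZ pD] x; have := pD x (- x); rewrite subrr -scaleN1r pZ.
by rewrite -[X in p X](scale0r 0) pZ normr0 mul0r normrN1 mul1r; lra.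
Qed.

Lemma null_seq_real (x : nat -> R^o) :
  x k @[k --> \oo] --> (0 : R) -> null_seq x.
Proof.
move=> x0 p [pZ _].
have -> : (fun k => p (x k)) = (fun k => `|x k| * p 1).
  by apply/funext => k; rewrite -pZ; congr p; rewrite /GRing.scale /= mulr1.
rewrite -[X in _ --> X](mul0r (p 1)) -[X in X * _](@normr0 _ R).
by apply: cvgM; [exact: cvg_norm|exact: cvg_cst].
Qed.

(** Each [p \o e i] is a seminorm on the coordinate space, and the triangle inequality bounds [p] by
    their sum. *)
Lemma null_seq_ffun (I : finType) V (x : nat -> {ffun I -> V}) :
  (forall i, null_seq (fun k => x k i)) -> null_seq x.
Proof.
move=> x0 p pN; have [pZ pD] := pN.
pose e i v : {ffun I -> V} := [ffun j => if j == i then v else 0].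
have eN i : seminorm (p \o e i).
  split => [a v|v w] /=.
    rewrite -pZ; congr p; apply/ffunP => j; rewrite !ffunE.
    by case: eqP; rewrite ?scaler0.
  rewrite (le_trans _ (pD _ _))// le_eqVlt; apply/orP; left; apply/eqP; congr p.
  by apply/ffunP => j; rewrite !ffunE; case: eqP; rewrite ?addr0.
have p_le k : p (x k) <= \sum_i p (e i (x k i)).
  have {1}-> : x k = \sum_i e i (x k i).
    apply/ffunP => j; rewrite sum_ffunE (bigD1 j)//= ffunE eqxx.
    by rewrite big1 ?addr0// => i ij; rewrite ffunE eq_sym (negbTE ij).
  elim/big_ind2: _ => //.
  - by rewrite -[X in p X](scale0r 0) pZ normr0 mul0r.
  - by move=> f a g b fa gb; rewrite (le_trans (pD _ _))// lerD.
apply: (@squeeze_cvgr _ _ _ _ (fun=> 0)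
  (fun k => \sum_i p (e i (x k i))) _).
- by apply: nearW => k; rewrite seminorm_ge0 ?p_le.
- exact: cvg_cst.
- have := @cvg_sumr R I (index_enum I) xpredT (fun k i => p (e i (x k i)))
    (fun=> 0) (fun i _ => x0 i _ (eN i)).
  by rewrite [X in _ --> X -> _]big1.
Qed.

Lemma null_seq_pair V V' (x : nat -> V) (y : nat -> V') :
  null_seq x -> null_seq y -> null_seq (fun k => (x k, y k) : (V * V')%type).
Proof.
move=> x0 y0 p pN; have [pZ pD] := pN.
have lN : seminorm (fun v : V => p (v, 0)).
  split => [a v|v w]; first by rewrite -pZ; congr p; congr pair; rewrite scaler0.
  by rewrite (le_trans _ (pD _ _))// le_eqVlt; apply/orP; left; apply/eqP;
     congr p; congr pair; rewrite addr0.
have rN : seminorm (fun v : V' => p (0, v)).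
  split => [a v|v w]; first by rewrite -pZ; congr p; congr pair; rewrite scaler0.
  by rewrite (le_trans _ (pD _ _))// le_eqVlt; apply/orP; left; apply/eqP;
     congr p; congr pair; rewrite addr0.
apply: (@squeeze_cvgr _ _ _ _ (fun=> 0)
  (fun k => p (x k, 0) + p (0, y k)) _).
- apply: nearW => k; rewrite seminorm_ge0//= (le_trans _ (pD _ _))//.
  by rewrite le_eqVlt; apply/orP; left; apply/eqP; congr p; congr pair;
     rewrite ?addr0 ?add0r.
- exact: cvg_cst.
- by have := cvgD (x0 _ lN) (y0 _ rN); rewrite addr0; apply.
Qed.

End NullSequences.

(** * The limit of the balances *)

Section SchemeLimit.
Context (R : realType) (d : nat) (G : mac_grid R d).
Implicit Types (K L : cell G) (s : face G).

Definition cvg_ffun (I : finType) (q : nat -> {ffun I -> R^o})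
  (l : {ffun I -> R^o}) := forall i, (q k i : R) @[k --> \oo] --> (l i : R).

(** For passing the balances to the limit: their left-hand sides vanish for every [k]. *)
Lemma cst0_cvg_eq0 (f : nat -> R) (l : R) :
  (forall k, f k = 0) -> f k @[k --> \oo] --> l -> l = 0.
Proof.
move=> f0; rewrite (_ : f = fun=> 0); last exact/funext.
by move=> /cvg_lim <-//; apply: lim_cst.
Qed.

Lemma pos_part_cvg (f : nat -> R) (l : R) :
  f k @[k --> \oo] --> l -> pos_part (f k) @[k --> \oo] --> pos_part l.
Proof.
have cont : continuous (@pos_part R).
  move=> x; apply: (@continuous_max R R id (fun=> 0)) => //; exact: cvg_cst.
by move=> fl; apply: continuous_cvg fl; exact: cont.
Qed.

Lemma neg_part_cvg (f : nat -> R) (l : R) :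
  f k @[k --> \oo] --> l -> neg_part (f k) @[k --> \oo] --> neg_part l.
Proof.
have cont : continuous (@neg_part R).
  move=> x; apply: (@continuous_min R R id (fun=> 0)) => //; exact: cvg_cst.
by move=> fl; apply: continuous_cvg fl; exact: cont.
Qed.

(** The upwind value jumps where the flux changes sign, but its product with the flux is continuous,
    as this form shows. *)
Lemma upwindE (u : HE G) (F : R) s e :
  F * upwind u F s e = pos_part F * u s + neg_part F * u (dual_neighbour s e).
Proof.
rewrite /upwind; case: ifPn => [F0|]; last rewrite -ltNge => /ltW F0.
  by rewrite pos_part_id// neg_part_eq0// mul0r addr0.
by rewrite pos_part_eq0// neg_part_id// mul0r add0r.
Qed.

Lemma grad_rescaled_pressure (eps : R) (p : LM G) s :
  grad (rescaled_pressure eps p) s = (eps ^+ 2)^-1 * grad p s.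
Proof. by rewrite /grad !ffunE; ring. Qed.

Lemma outward_cvg (u : nat -> HE G) (U : HE G) s K : cvg_ffun u U ->
  outward (u k) s K @[k --> \oo] --> outward U s K.
Proof. by move=> uU; apply: cvgM; [exact: uU|exact: cvg_cst]. Qed.

Lemma grad_cvg (p : nat -> LM G) (P : LM G) s : cvg_ffun p P ->
  grad (p k) s @[k --> \oo] --> grad P s.
Proof.
move=> pP; apply: cvgM; first exact: cvg_cst.
by apply: cvgB; exact: pP.
Qed.

Lemma dual_density_cvg (rho : nat -> LM G) (Rho : LM G) s : cvg_ffun rho Rho ->
  dual_density (rho k) s @[k --> \oo] --> dual_density Rho s.
Proof.
move=> rR; apply: cvgM; last exact: cvg_cst.
by apply: cvgD; (apply: cvgM; last exact: cvg_cst);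
  (apply: cvgM; first exact: cvg_cst); exact: rR.
Qed.

Lemma dual_density_gt0 (rho : LM G) s : (forall K, 0 < rho K) ->
  0 < dual_density rho s.
Proof.
move=> r0; rewrite divr_gt0 ?dual_vol_gt0// addr_gt0// divr_gt0// mulr_gt0//;
  exact: cell_vol_gt0.
Qed.

Section Limits.
Variables (rho : nat -> LM G) (u : nat -> HE G) (Rho : LM G) (U : HE G).
Hypotheses (rho_cvg : cvg_ffun rho Rho) (u_cvg : cvg_ffun u U).

Lemma mass_flux_cvg s K :
  mass_flux (rho k) (u k) s K @[k --> \oo] --> mass_flux Rho U s K.
Proof.
apply: cvgM; first exact: cvg_cst.
apply: cvgD; apply: cvgM; try exact: rho_cvg.
  by apply: pos_part_cvg; exact: outward_cvg.
by apply: neg_part_cvg; exact: outward_cvg.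
Qed.

Lemma momentum_convection_cvg s :
  momentum_convection (rho k) (u k) s @[k --> \oo]
    --> momentum_convection Rho U s.
Proof.
apply: cvgM; first exact: cvg_cst; apply: cvg_sumr => e _.
have flux_cvg : dual_flux (mass_flux (rho k) (u k)) s e @[k --> \oo]
    --> dual_flux (mass_flux Rho U) s e.
  rewrite /dual_flux /=; case: (e.1 == dir s); (apply: cvgM; last exact: cvg_cst).
    by apply: cvgB; exact: mass_flux_cvg.
  by apply: cvgD; exact: mass_flux_cvg.
rewrite upwindE; under eq_cvg do rewrite upwindE.
apply: cvgD; apply: cvgM; try exact: u_cvg.
  exact: pos_part_cvg.
exact: neg_part_cvg.
Qed.

Variables (dt : R) (rho' : nat -> LM G) (Rho' : LM G).
Hypothesis rho'_cvg : cvg_ffun rho' Rho'.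

Lemma mass_balance_limit :
  (forall k, mass_balance dt (rho k) (rho' k) (u k)) ->
  mass_balance dt Rho Rho' U.
Proof.
move=> bal K; apply: (cst0_cvg_eq0 (fun k => bal k K)).
apply: cvgD; (apply: cvgM; first exact: cvg_cst).
  by apply: cvgB; [exact: rho'_cvg|exact: rho_cvg].
by apply: cvg_sumr => s _; exact: mass_flux_cvg.
Qed.

Section Momentum.
Variables (u' : nat -> HE G) (q : nat -> LM G) (Q : LM G).
Hypothesis q_cvg : cvg_ffun q Q.
Hypothesis bal : forall k,
  momentum_balance dt (rho k) (rho' k) (u k) (u' k) (grad (q k)).

Lemma momentum_balance_limit (U' : HE G) : cvg_ffun u' U' ->
  momentum_balance dt Rho Rho' U U' (grad Q).
Proof.
move=> u'_cvg s; apply: (cst0_cvg_eq0 (fun k => bal k s)).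
apply: cvgD; last exact: grad_cvg.
apply: cvgD; last exact: momentum_convection_cvg.
apply: cvgM; first exact: cvg_cst.
by apply: cvgB; (apply: cvgM; [exact: dual_density_cvg|]);
  [exact: u'_cvg|exact: u_cvg].
Qed.

(** The momentum balance can be solved for [u'] by dividing by the new dual density, whose limit is
    positive. *)
Lemma velocity_cvg : 0 < dt -> (forall k K, 0 < rho' k K) ->
  (forall K, 0 < Rho' K) -> exists U' : HE G, cvg_ffun u' U'.
Proof.
move=> dt0 rho'0 Rho'0; exists [ffun s => (dual_density Rho s * U s
  - dt * (momentum_convection Rho U s + grad Q s)) / dual_density Rho' s] => s.
rewrite ffunE (_ : (fun k => u' k s) = fun k => (dual_density (rho k) s * u k s
  - dt * (momentum_convection (rho k) (u k) s + grad (q k) s))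
  / dual_density (rho' k) s).
  apply: cvgM; last first.
    by apply: cvgV; [rewrite gt_eqF ?dual_density_gt0|exact: dual_density_cvg].
  apply: cvgB; first by apply: cvgM; [exact: dual_density_cvg|exact: u_cvg].
  apply: cvgM; first exact: cvg_cst.
  by apply: cvgD; [exact: momentum_convection_cvg|exact: grad_cvg].
apply/funext => k; have := bal k s; have := dual_density_gt0 s (rho'0 k).
move: (dual_density _ _) (dual_density _ _) (momentum_convection _ _ _) => D D' M.
move: (grad _ _) => g D0 h; apply/eqP; rewrite eq_sym -subr_eq0; apply/eqP.
transitivity (- (dt / D') * 0); last by rewrite mulr0.
by rewrite -h; field; rewrite !gt_eqF.
Qed.

End Momentum.

Lemma divergence_limit (kappa : R) (theta theta' : nat -> LM G)
    (q : nat -> LM G) (Q : LM G) : cvg_ffun q Q ->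
  (forall K, (rho k K * theta k K : R) @[k --> \oo] --> (1 : R)) ->
  (forall K, (rho' k K * theta' k K : R) @[k --> \oo] --> (1 : R)) ->
  (forall k, temperature_balance dt (rho k) (rho' k) (theta k) (theta' k) (u k)
    [ffun s => kappa * grad (q k) s]) ->
  forall K, divM (U - [ffun s => kappa * grad Q s] : HE G) K = 0.
Proof.
move=> q_cvg w_cvg w'_cvg bal K.
(* The goal takes the shape of the limit of the temperature balance: [rho * theta] tends to 1 at
   both levels, so the time difference becomes [1 - 1]. *)
rewrite -[LHS]add0r -[X in X + _](mulr0 dt^-1) -[X in _ * X + _](subrr 1).
apply: (cst0_cvg_eq0 (fun k => bal k K)).
apply: cvgD; (apply: cvgM; first exact: cvg_cst).
  by apply: cvgB; [exact: w'_cvg|exact: w_cvg].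
apply: cvg_sumr => s _; apply: cvgM; first exact: cvg_cst.
set dU : HE G := [ffun s => kappa * grad Q s].
have du_cvg : cvg_ffun (fun k => [ffun s => kappa * grad (q k) s] : HE G) dU.
  move=> s'; rewrite ffunE; under eq_cvg do rewrite ffunE.
  by apply: cvgM; [exact: cvg_cst|exact: grad_cvg].
(* With both weights equal to 1, the positive and negative parts recombine into [U - dU]. *)
have -> : outward (U - dU : HE G) s K
    = 1 * split_pos U dU s K + 1 * split_neg U dU s K.
  rewrite !mul1r /split_pos /split_neg addrACA -opprD pos_negD.
  by rewrite [neg_part _ + _]addrC pos_negD /outward !ffunE mulrBl.
apply: cvgD; apply: cvgM; try exact: w'_cvg.
  apply: cvgB; [apply: pos_part_cvg|apply: neg_part_cvg]; exact: outward_cvg.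
apply: cvgB; [apply: neg_part_cvg|apply: pos_part_cvg]; exact: outward_cvg.
Qed.

End Limits.
End SchemeLimit.

(** * Lebesgue norms of cell functions *)

Section CellFunctions.
Context (R : realType) (d : nat) (G : mac_grid R d).
Implicit Types (K L : cell G).

Lemma node_mono i j k : (j <= k <= ncell G i)%N -> node G i j <= node G i k.
Proof.
elim: k => [|k IH] /andP[jk kn]; first by move: jk; rewrite leqn0 => /eqP ->.
move: jk; rewrite leq_eqVlt => /predU1P[->//|jk].
by rewrite (le_trans (IH _) (ltW (node_lt kn)))// -ltnS jk ltnW.
Qed.

(** Cells are half-open: with a smaller index in some direction, one cell ends no later than the
    other starts. *)
Lemma cell_set_inj K L x : cell_set K x -> cell_set L x -> K = L.
Proof.
have ord_le K' L' i : cell_set K' x -> cell_set L' x -> (K' i <= L' i)%N.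
  move=> /(_ i) /andP[K1 _] /(_ i) /andP[_ L2].
  rewrite leqNgt; apply/negP => LK.
  have LK' : node G i (L' i).+1 <= node G i (K' i).
    by rewrite node_mono// LK ltnW.
  by have := lt_le_trans L2 (le_trans LK' K1); rewrite ltxx.
move=> Kx Lx; apply/ffunP => i; apply/val_inj/eqP.
by rewrite eqn_leq !ord_le.
Qed.

(** In each direction, the index is found by going down from the last node until a node is at most
    the coordinate. *)
Lemma domain_cell x : domain G x -> exists K, cell_set K x.
Proof.
move=> xG; have cover i : exists k : 'I_(ncell G i),
    node G i k <= tnth x i < node G i k.+1.
  have /andP[x0 xn] := xG i; move: xn.
  suff above n : (n <= ncell G i)%N -> tnth x i < node G i n ->
      exists k : 'I_(ncell G i), node G i k <= tnth x i < node G i k.+1.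
    exact: above.
  elim: n => [_|n IH nn xn]; first by rewrite ltNge x0.
  have [xn'|xn'] := leP (node G i n) (tnth x i).
    by exists (Ordinal nn); rewrite /= xn'.
  exact: IH (ltnW nn) xn'.
exists [ffun i => projT1 (cid (cover i))] => i; rewrite ffunE.
exact: projT2 (cid (cover i)).
Qed.

Lemma cell_fun_cell (q : LM G) K x : cell_set K x -> cell_fun q x = q K.
Proof.
move=> Kx; rewrite /cell_fun (bigD1 K)//= indicE mem_set// mulr1 big1 ?addr0//.
move=> L LK; rewrite indicE memNset ?mulr0// => Lx.
by move: LK; rewrite (cell_set_inj Lx Kx) eqxx.
Qed.

Lemma LpOmega_cell_fun_le (gamma delta : R) (q : LM G) :
  0 < gamma -> 0 <= delta ->
  (forall K, `|q K - 1| <= delta) ->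
  (LpOmega G gamma%:E (fun x => cell_fun q x - 1)%R
   <= (delta * fine (lebesgue R d (domain G)) `^ gamma^-1)%:E)%E.
Proof.
move=> g0 de0 qd; rewrite /LpOmega unlock.
have mD : measurable (domain G) by exact: measurable_box.
have volE : lebesgue R d (domain G) = (fine (lebesgue R d (domain G)))%:E.
  by rewrite lebesgue_box// => i; apply: node_mono; rewrite leqnn.
set V := fine _ in volE *.
have V0 : 0 <= V by exact/fine_ge0/measure_ge0.
(* The bound is the norm of the constant [delta] on the domain, so it suffices to compare
   integrands. *)
have ->: (delta * V `^ gamma^-1)%:E = (((delta `^ gamma * V) `^ gamma^-1)%:E)%R.
  rewrite powRM ?powR_ge0// -powRrM mulfV ?gt_eqF// powRr1//.
rewrite -poweR_EFin; apply: gt0_ler_poweR.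
- by rewrite invr_ge0 ltW.
- by rewrite in_itv/= leey integral_ge0// => x _; exact: poweR_ge0.
- by rewrite in_itv/= leey lee_fin mulr_ge0// powR_ge0.
rewrite EFinM -volE -integral_cst//.
rewrite [leRHS]integral_mkcond; apply: ge0_le_integral => //=.
- apply/measurable_EFinP; apply: (measurableT_comp (measurable_powR _)) => //.
  apply: measurableT_comp => //; apply/(measurable_restrictT _ mD).
  apply: measurable_funB => //; apply: measurable_sum => K.
  apply: measurable_funM => //; apply: measurable_indic.
  exact: measurable_box.
- by apply/(measurable_restrictT _ mD); exact: measurable_cst.
- move=> x _; rewrite !patchE; case: ifPn => [|xD]; last first.
    by rewrite normr0 powR0 ?gt_eqF.
  rewrite inE => /domain_cell[K Kx]; rewrite (cell_fun_cell _ Kx) lee_fin.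
  by rewrite ge0_ler_powR ?nnegrE// ltW.
Qed.

End CellFunctions.

(** * The zero Mach number limit *)

Lemma trajectory_null_seq (R : realType) (d : nat) (G : mac_grid R d) (N : nat)
    (rho : nat -> nat -> LM G) (u : nat -> nat -> HE G)
    (pi : nat -> nat -> LM G)
    (rhol : nat -> LM G) (U : nat -> HE G) (pil : nat -> LM G) :
  (forall n, (n <= N)%N -> cvg_ffun (rho^~ n) (rhol n)) ->
  (forall n, (n <= N)%N -> cvg_ffun (u^~ n) (U n)) ->
  (forall n, (n < N)%N -> cvg_ffun (pi^~ n.+1) (pil n.+1)) ->
  null_seq (fun k =>
    trajectory N (rho k) (u k) (pi k) - trajectory N rhol U pil).
Proof.
have sub_null (f : nat -> R) (l : R) :
    f k @[k --> \oo] --> l -> null_seq (fun k => f k - l : R^o).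
  move=> fl; apply: null_seq_real; rewrite -[X in _ --> X](subrr l).
  by apply: cvgB => //; exact: cvg_cst.
move=> rho_cvg u_cvg pi_cvg; apply: null_seq_pair; first apply: null_seq_pair.
- apply: null_seq_ffun => n; apply: null_seq_ffun => K.
  rewrite (_ : (fun k => _) = fun k => rho k n K - rhol n K : R^o).
    by apply: sub_null; apply: rho_cvg; rewrite -ltnS.
  by apply/funext => k; rewrite !ffunE.
- apply: null_seq_ffun => n; apply: null_seq_ffun => s.
  rewrite (_ : (fun k => _) = fun k => u k n s - U n s : R^o).
    by apply: sub_null; apply: u_cvg; rewrite -ltnS.
  by apply/funext => k; rewrite !ffunE.
- apply: null_seq_ffun => n; apply: null_seq_ffun => K.
  rewrite (_ : (fun k => _) = fun k => pi k n.+1 K - pil n.+1 K : R^o).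
    by apply: sub_null; exact: pi_cvg.
  by apply/funext => k; rewrite !ffunE.
Qed.

Theorem theorem5p4 (R : realType) (d : nat) (hd : (0 < d)%N)
    (gamma eta T : R) (N : nat)
    (hgamma : 1 < gamma) (heta : 0 < eta) (hT : 0 < T) (hN : (0 < N)%N)
    (G : mac_grid R d) (eps : nat -> R)
    (eps_gt0 : forall k, 0 < eps k) (eps_cvg : eps @ \oo --> (0 : R))
    (rho0 : nat -> Rd R d -> R) (u0 : nat -> 'I_d -> Rd R d -> R)
    (theta0 : nat -> Rd R d -> R)
    (data_Linfty : forall k,
       [/\ in_Linfty G (rho0 k), forall i, in_Linfty G (u0 k i) &
           in_Linfty G (theta0 k)])
    (rho : nat -> nat -> LM G) (u : nat -> nat -> HE G)
    (theta : nat -> nat -> LM G)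
    (scheme : forall k, compressible_scheme gamma eta (T / N%:R) N (eps k)
                          (rho k) (u k) (theta k))
    (initialisation : forall k, initial_averages (rho0 k) (theta0 k) (u0 k)
                                  (rho k 0%N) (u k 0%N) (theta k 0%N))
    (c C : R) (c_gt0 : 0 < c) (C_gt0 : 0 < C)
    (data_ill_prepared : forall k,
       ill_prepared G c C (eps k) (rho0 k) (theta0 k) (u0 k))
    (averages_ill_prepared : forall k,
       ill_prepared_averages C (eps k) (rho k 0%N) (theta k 0%N))
    (rho_lb rho_ub : R) (rho_lb_gt0 : 0 < rho_lb) (rho_lb_ub : rho_lb < rho_ub)
    (rho_bounds : forall k n K, (n <= N)%N -> rho_lb < rho k n K < rho_ub)
    (stable : forall k n, (n < N)%N ->
       stability eta (T / N%:R) (rho k n) (u k n)) :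
  let pi k n :=
    rescaled_pressure (eps k) (pressure gamma (rho k n) (theta k n)) in
  LinfLp G N gamma%:E
    (fun n x => cell_fun [ffun K => rho k n K * theta k n K] x - 1)
    @[k --> \oo] --> 0%E /\
  exists (phi : nat -> nat) (rhol : nat -> LM G) (U : nat -> HE G)
         (pil : nat -> LM G),
    [/\ {homo phi : i j / (i < j)%N},
        forall nrm : discrete_space G N -> R, is_norm nrm ->
          nrm (trajectory N (rho (phi k)) (u (phi k)) (pi (phi k))
               - trajectory N rhol U pil) @[k --> \oo] --> (0 : R) &
        incompressible_scheme eta (T / N%:R) N rhol U pil].
Proof.
move=> pi; have dt0 : 0 < T / N%:R by rewrite divr_gt0// ltr0n.
have [B B0 bounds] := compressible_scheme_bounds G N C hgamma heta dt0.
pose delta k := B * eps k ^+ 2 + C * eps k.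
have delta_cvg : delta k @[k --> \oo] --> (0 : R).
  rewrite -[X in _ --> X](addr0 0) -[X in _ --> X + _](mulr0 B).
  rewrite -[X in _ --> _ + X](mulr0 C) -[X in _ --> B * X + _](mulr0 0).
  apply: cvgD; (apply: cvgM; first exact: cvg_cst) => //.
  exact: cvgM.
(* The uniform bounds hold from [k0] on; the subsequence is extracted from these indices. *)
have [k0 _ eps_small] : \forall k \near \oo, C * eps k <= 2^-1.
  have : C * eps k @[k --> \oo] --> C * 0 by apply: cvgM => //; exact: cvg_cst.
  by rewrite mulr0 => /cvgr_le; apply; rewrite invr_gt0.
have {}bounds k (kk0 : (k0 <= k)%N) :=
  bounds _ _ _ _ (eps_gt0 k) (eps_small k kk0)
  (scheme k) (averages_ill_prepared k) (stable k).
have delta_ge0 k : 0 <= delta k.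
  by rewrite addr_ge0 ?mulr_ge0 ?exprn_ge0// ltW.
split.
  pose bound k := delta k * fine (lebesgue R d (domain G)) `^ gamma^-1.
  have bound_cvg : (bound k)%:E @[k --> \oo] --> 0%E.
    apply: cvg_EFin; first exact: nearW.
    rewrite -[X in _ --> X](mul0r (fine (lebesgue R d (domain G)) `^ gamma^-1)).
    by apply: cvgM => //; exact: cvg_cst.
  apply: (@squeeze_cvge _ _ _ _ (fun=> 0%E) _ (fun k => (bound k)%:E)) => //;
    last exact: cvg_cst.
  exists k0 => // k /= kk0; have [_ _ w_le] := bounds k kk0.
  rewrite /LinfLp; elim/big_ind: _ => //.
  - by rewrite lexx lee_fin mulr_ge0 ?powR_ge0.
  - by move=> x y /andP[x0 xb] /andP[y0 yb]; rewrite le_max x0 ge_max xb yb.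
  - move=> n _; rewrite Lnorm_ge0 /=; apply: LpOmega_cell_fun_le => //.
      by rewrite (lt_trans ltr01).
    by move=> K; rewrite ffunE; apply: w_le; rewrite -ltnS.
(* The scalars made convergent by extraction: densities at all levels, velocities at level 0,
   pressures at levels 1 to [N]. The later velocities follow from the momentum balance. *)
pose I : finType := ('I_N.+1 * cell G + face G + 'I_N * cell G)%type.
pose f k (i : I) : R := match i with
  | inl (inl (n, K)) => rho (k0 + k)%N n K
  | inl (inr s) => u (k0 + k)%N 0%N s
  | inr (n, K) => pi (k0 + k)%N n.+1 K
  end.
have f_le k i : `|f k i| <= rho_ub + B.
  have [u_le pi_le _] := bounds _ (leq_addr k k0).
  have ub0 : 0 < rho_ub by exact: lt_trans rho_lb_ub.
  case: i => [[[n K]|s]|[n K]] /=.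
  - have /andP[lb ub] := rho_bounds (k0 + k)%N n K (ltn_ord n).
    by rewrite ger0_norm ?(ltW (lt_trans rho_lb_gt0 lb))//
      (le_trans (ltW ub))// lerDl.
  - by rewrite (le_trans (u_le _ s hN))// lerDr ltW.
  - by rewrite (le_trans (pi_le _ K (ltn_ord n)))// lerDr ltW.
have [phi0 phi0_incr f_cvg] := bolzano_weierstrass_finite f_le.
pose phi k := (k0 + phi0 k)%N.
have phi_incr : {homo phi : i j / (i < j)%N}.
  by move=> i j ij; rewrite ltn_add2l phi0_incr.
(* [limn] gives a default where there is no limit; convergence is proved below at the levels that
   [trajectory] records. *)
pose rhol n : LM G := [ffun K => limn (fun k => rho (phi k) n K : R)].
pose U n : HE G := [ffun s => limn (fun k => u (phi k) n s : R)].
pose pil n : LM G := [ffun K => limn (fun k => pi (phi k) n K : R)].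
have rho_cvg n : (n <= N)%N -> cvg_ffun (fun k => rho (phi k) n) (rhol n).
  move=> nN K; rewrite ffunE.
  exact: (f_cvg (inl (inl (Ordinal (nN : (n < N.+1)%N), K)))).
have pi_cvg n : (n < N)%N -> cvg_ffun (fun k => pi (phi k) n.+1) (pil n.+1).
  by move=> nN K; rewrite ffunE; exact: (f_cvg (inr (Ordinal nN, K))).
(* The lower density bound is uniform in [k], so the limit density stays positive and the momentum
   balance can be solved in the limit. *)
have rhol_gt0 n K : (n <= N)%N -> 0 < rhol n K.
  move=> nN; apply: lt_le_trans rho_lb_gt0 _.
  apply: (cvgr_to_ge (rho_cvg n nN K)); apply: nearW => k.
  by have /andP[/ltW] := rho_bounds (phi k) n K nN.
have momentum n (nN : (n < N)%N) k : momentum_balance (T / N%:R) (rho (phi k) n)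
    (rho (phi k) n.+1) (u (phi k) n) (u (phi k) n.+1) (grad (pi (phi k) n.+1)).
  move=> s; have [_ /(_ s) <- _] := (scheme (phi k)).2 n nN.
  by rewrite grad_rescaled_pressure.
(* Level 0 comes from the extraction and level [n.+1] from the momentum balance; uniqueness of
   limits identifies the latter with [U n.+1]. *)
have u_cvg n : (n <= N)%N -> cvg_ffun (fun k => u (phi k) n) (U n).
  elim: n => [_ s|n IH nN].
    by rewrite ffunE; exact: (f_cvg (inl (inr s))).
  have [U' U'_cvg] : exists U' : HE G, cvg_ffun (fun k => u (phi k) n.+1) U'.
    apply: (velocity_cvg (rho_cvg n (ltnW nN)) (IH (ltnW nN)) (rho_cvg _ nN)
      (pi_cvg n nN) (momentum n nN) dt0) => [k K|K]; last exact: rhol_gt0.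
    by have [] := (scheme (phi k)).1 n.+1 K nN.
  by move=> s; rewrite ffunE (cvg_lim _ (U'_cvg s))//; exact: U'_cvg.
have w_cvg n (nN : (n <= N)%N) K :
    (rho (phi k) n K * theta (phi k) n K : R) @[k --> \oo] --> (1 : R).
  have phi_cvg := homo_ltn_cvg phi_incr.
  have dphi_cvg : delta (phi k) @[k --> \oo] --> (0 : R).
    exact: cvg_comp phi_cvg delta_cvg.
  apply/cvgrPdist_le => e e0; move/cvgr_le: dphi_cvg => /(_ e e0).
  apply: filterS => k; apply: le_trans.
  by have [_ _] := bounds (phi k) (leq_addr _ _); rewrite distrC; apply.
exists phi, rhol, U, pil; split => //.
  move=> nrm [_ _ nrmZ nrmD].
  exact: (trajectory_null_seq rho_cvg u_cvg pi_cvg (conj nrmZ nrmD)).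
move=> n nN; split.
- apply: (mass_balance_limit (rho_cvg n (ltnW nN)) (u_cvg n (ltnW nN))
    (rho_cvg n.+1 nN)) => k.
  by have [] := (scheme (phi k)).2 n nN.
- exact: (momentum_balance_limit (rho_cvg n (ltnW nN)) (u_cvg n (ltnW nN))
    (rho_cvg n.+1 nN) (pi_cvg n nN) (momentum n nN) (u_cvg n.+1 nN)).
- apply: (divergence_limit (dt := T / N%:R) (u_cvg n (ltnW nN)) (pi_cvg n nN)
    (w_cvg n (ltnW nN)) (w_cvg n.+1 nN)) => k.
  have [_ _] := (scheme (phi k)).2 n nN.
  (* The division by [eps ^+ 2] is absorbed into the rescaled pressure. *)
  rewrite (_ : [ffun s => _ / _ * _] = [ffun s : face G =>
    eta * (T / N%:R) * grad (pi (phi k) n.+1) s : R^o])//.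
  apply/ffunP => s; rewrite !ffunE [grad (pi _ _) s]grad_rescaled_pressure.
  exact/esym/mulrA.
Qed.
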